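(* Assume $\mathsf{P} \neq \mathsf{NP}$. Then for every $\epsilon > 0$ there is no polynomial-time $(3-\epsilon)$-approximation algorithm for the one-per-group fair $k$-center problem, i.e., for the fair $k$-center problem restricted to instances in which the points are partitioned into exactly $k$ groups and exactly one center must be selected from each group.
   Context: The fair $k$-center problem: the input is a finite metric space $(U,d)$ with $|U| = n$, a partition of $U$ into $t$ pairwise disjoint groups $G_1,\dots,G_t$ (with $\bigcup_{i} G_i = U$), and a requirement vector $(r_1,\dots,r_t)$ of nonnegative integers with $\sum_{i=1}^t r_i = k$. A feasible solution is a set $S \subseteq U$ with $|S| = k$ and $|S \cap G_i| = r_i$ for every $i$. The objective is to minimize $\mathrm{cost}(S,U) := \max_{u \in U} \min_{s \in S} d(u,s)$. The one-per-group fair $k$-center problem is the special case with $t = k$ groups $G_1,\dots,G_k$ and requirement vector $(1,1,\dots,1)$, so a feasible solution contains exactly one point from each group. A polynomial-time $\alpha$-approximation algorithm is one that, on every instance, runs in time polynomial in the input size and outputs a feasible solution $S$ with $\mathrm{cost}(S,U) \leq \alpha \cdot \mathrm{OPT}$, where $\mathrm{OPT}$ is the minimum cost over all feasible solutions. *)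

(* Defs.v *)
From HB Require Import structures.
From mathcomp Require Import all_boot all_order all_algebra.
From mathcomp Require Import reals.

Set Implicit Arguments.
Unset Strict Implicit.
Unset Printing Implicit Defensive.

Import Order.TTheory GRing.Theory Num.Theory.

Local Open Scope ring_scope.

Definition bits := seq bool.

(* [None] is the blank, [inl b] are the input/output bits and [inr a] the
   auxiliary tape symbols of the machine. *)
Definition symbol (A : finType) : finType := option (bool + A)%type.

Inductive direction := GoLeft | Stay | GoRight.

Record machine := Machine {
  mstate : finType;
  maux : finType;
  mtapes : nat; (* number of tapes, minus one *)
  mstart : mstate;
  mhalt : pred mstate;
  mtrans : mstate -> {ffun 'I_mtapes.+1 -> symbol maux} ->
           mstate * {ffun 'I_mtapes.+1 -> symbol maux * direction} }.

(* A two-way infinite tape, blank outside the recorded part; [tleft] lists the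
   cells to the left of the head, nearest first. *)
Record tape (A : finType) := Tape {
  tleft : seq (symbol A);
  thead : symbol A;
  tright : seq (symbol A) }.

Definition blank_tape (A : finType) : tape A := Tape [::] None [::].

Definition input_tape (A : finType) (x : bits) : tape A :=
  if x is b :: s then
    Tape [::] (Some (inl b)) [seq Some (inl c) | c : bool <- s]
  else blank_tape A.

Definition write_tape (A : finType) (a : symbol A) (T : tape A) : tape A :=
  Tape (tleft T) a (tright T).

Definition move_tape (A : finType) (m : direction) (T : tape A) : tape A :=
  match m with
  | Stay => T
  | GoLeft =>
      if tleft T is a :: l then Tape l a (thead T :: tright T)
      else Tape [::] None (thead T :: tright T)
  | GoRight =>
      if tright T is a :: r then Tape (thead T :: tleft T) a r
      else Tape (thead T :: tleft T) None [::]
  end.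

Fixpoint bit_prefix (A : finType) (s : seq (symbol A)) : bits :=
  if s is Some (inl b) :: s' then b :: bit_prefix s' else [::].

Definition output_tape (A : finType) (T : tape A) : bits :=
  bit_prefix (thead T :: tright T).

Record config (M : machine) := Config {
  cstate : mstate M;
  ctape : 'I_(mtapes M).+1 -> tape (maux M) }.

Definition init_config (M : machine) (x : bits) : config M :=
  Config (mstart M)
    (fun i => if i == ord0 then input_tape (maux M) x
              else blank_tape (maux M)).

Definition step (M : machine) (C : config M) : config M :=
  if mhalt (cstate C) then C
  else
    let: (q, w) := mtrans (cstate C) [ffun i => thead (ctape C i)] in
    Config q (fun i => move_tape (w i).2 (write_tape (w i).1 (ctape C i))).

Definition run (M : machine) (x : bits) (t : nat) : config M :=
  iter t (@step M) (init_config M x).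

(* The output is the maximal block of bits of tape 0 starting at the head. *)
Definition halts_with (M : machine) (x : bits) (t : nat) (y : bits) : Prop :=
  mhalt (cstate (run M x t)) /\ output_tape (ctape (run M x t) ord0) = y.

(* Prefix-free code: every bit is preceded by [true], and [false] ends. *)
Definition delimit (x : bits) : bits :=
  rcons (flatten [seq [:: true; b] | b <- x]) false.

Definition pair_bits (x y : bits) : bits := delimit x ++ y.

Definition language := bits -> Prop.

Definition inP (L : language) : Prop :=
  exists (M : machine) (p : {poly nat}), forall x : bits,
    exists (t : nat) (b : bool),
      [/\ (t <= p.[size x])%N, halts_with M x t [:: b] & b <-> L x].

Definition inNP (L : language) : Prop :=
  exists (V : language) (p : {poly nat}), inP V /\
    forall x : bits, L x <->
      exists y : bits, (size y <= p.[size x])%N /\ V (pair_bits x y).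

Definition P_neq_NP : Prop := ~ (forall L : language, inP L <-> inNP L).

(* The points are 'I_n and the distances are rational, so that instances can be
   written on the tape of a machine. *)
Record fair_instance := FairInstance {
  npoints : nat;
  ngroups : nat;
  dist : 'I_npoints -> 'I_npoints -> rat;
  group_of : 'I_npoints -> 'I_ngroups;
  req : 'I_ngroups -> nat;
  npoints_gt0 : (0 < npoints)%N;
  dist_ge0 : forall u v, 0 <= dist u v;
  dist_eq0 : forall u v, dist u v = 0 <-> u = v;
  dist_sym : forall u v, dist u v = dist v u;
  dist_triangle : forall u v w, dist u w <= dist u v + dist v w;
  group_of_surj : forall i, exists u, group_of u = i }.

Section FairKCenter.
Variable I : fair_instance.

Definition group (i : 'I_(ngroups I)) : {set 'I_(npoints I)} :=
  [set u | group_of u == i].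

Definition ncenters : nat := (\sum_(i < ngroups I) req i)%N.

Definition feasible (S : {set 'I_(npoints I)}) : bool :=
  (#|S| == ncenters) && [forall i, #|S :&: group i| == req i].

(* Serves as the neutral element of the minima below: it is an upper bound of
   all distances and of all costs, so it never affects a nonempty minimum. *)
Definition diameter : rat :=
  \big[Num.max/0]_(u < npoints I) \big[Num.max/0]_(v < npoints I) dist u v.

Definition cost (S : {set 'I_(npoints I)}) : rat :=
  \big[Num.max/0]_(u < npoints I) \big[Num.min/diameter]_(s in S) dist u s.

Definition opt : rat :=
  \big[Num.min/diameter]_(S : {set 'I_(npoints I)} | feasible S) cost S.

End FairKCenter.

Definition one_per_group (I : fair_instance) : Prop :=
  ngroups I = ncenters I /\ forall i : 'I_(ngroups I), req i = 1%N.

(* Binary expansion, least significant bit first, without leading zeros. *)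
Definition nat_bits (n : nat) : bits :=
  mkseq (fun i => odd (n %/ 2 ^ i)%N) (up_log 2 n.+1).

Definition encode_nat (n : nat) : bits := delimit (nat_bits n).

(* Only used on nonnegative rationals. *)
Definition encode_rat (q : rat) : bits :=
  encode_nat `|numq q|%N ++ encode_nat `|denq q|%N.

Definition encode_instance (I : fair_instance) : bits :=
  encode_nat (npoints I) ++ encode_nat (ngroups I) ++
  flatten [seq encode_nat (group_of u) | u <- enum 'I_(npoints I)] ++
  flatten [seq encode_nat (req i) | i <- enum 'I_(ngroups I)] ++
  flatten [seq encode_rat (dist u v) | u <- enum 'I_(npoints I),
                                       v <- enum 'I_(npoints I)].

Definition encode_solution (I : fair_instance) (S : {set 'I_(npoints I)}) :
  bits := [seq u \in S | u <- enum 'I_(npoints I)].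

(* The time bound and the guarantee are required on the instances of the class
   only; the machine is unconstrained on all other strings. *)
Definition poly_time_approx (R : realType) (inst : fair_instance -> Prop)
    (alpha : R) (M : machine) : Prop :=
  exists p : {poly nat}, forall I : fair_instance, inst I ->
    exists (t : nat) (S : {set 'I_(npoints I)}),
      [/\ (t <= p.[size (encode_instance I)])%N,
          halts_with M (encode_instance I) t (encode_solution S),
          feasible S
        & ratr (cost S) <= alpha * ratr (opt I)].

(* Main.v *)
(** Let [L] be in NP.  The runs of a verifier on [x] form the solutions of a
    constraint problem: choose a value for every cell of the computation
    tableau so that each clause, a set of pairs (cell, value), is hit.  It is
    turned into points at mutual distances 1, 2 or 3:
    - a point [Y(c, w)] for each cell [c] and value [w];
    - for each clause [C], a copy [A(C, c, w)] of these points;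
    - a client for each pair of clauses [(D, C)], and an isolated point [z].
    The groups are the [Y(c, _)], the [A(C, c, _)], and all clients with [z],
    so that [z] has to be selected and no client is.  The points [Y(c, _)] of a cell are
    at distance 1 from each other, [A(C, _, _)] is at distance 1 from the points [Y]
    that belong to [C], and the client [(D, C)] is at distance 1 from the
    [A(C, c, w)] with [(c, w)] in [D], hence 2 from the [Y(c, w)] in [C]; it is at
    distance 3 from the other [A] and [Y].  All points are at distance 3 from [z],
    and the remaining distances are 2.
    A solution of the constraint problem gives a selection of cost 1.  In a
    selection of cost less than 3, either the choice made by the [Y] groups hits
    all clauses, or it misses some [C], and then the clients [(D, C)] can only be
    served by [A(C, _, _)], so the choice made there hits all clauses [D].
    A polynomial-time machine thus decides [L]: it prints the instance, runs the
    approximation algorithm on it, and checks that the cost of the answer is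
    less than 3. *)
Require Import Defs.
From HB Require Import structures.
From mathcomp Require Import all_boot all_order all_algebra.
From mathcomp Require Import reals zify.
(* all_boot declares a [thead] of its own. *)
Import Defs.

Set Implicit Arguments.
Unset Strict Implicit.
Unset Printing Implicit Defensive.

(** * Composing Turing machines *)

(** Why copies are needed: for a selection of cost 1, every unselected [Y(c, w)] must have a center
    at distance 1, and the groups [Y(c, _)] are cliques for that purpose. A client at distance 1
    from [Y(c, w)] itself would then be within 2 of whichever point of the group is selected, and no
    selection could miss it by 3. The clients are therefore attached to the copies, which are at
    distance 2 from each other, and the triangle inequality only brings a client [(D, C)] close to
    those [Y] that hit [C]. If the selected [Y] violate [C], they are all at distance 3 from it. The
    reduction starts from an arbitrary verifier, and the machine that carries it out has to be
    exhibited. For this the instance is printed by nested loops whose tests only compare two loop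
    variables, up to a successor, or look up a stored bit; the clauses of the tableau are designed
    so that such tests suffice. As [P_neq_NP] denies that the two classes coincide, the
    contradiction also requires a machine for the inclusion of P in NP. *)

Section Tapes.
Variable A : finType.
Implicit Types (T U : tape A) (l : bits).

(* Equality up to the blanks recorded at the ends of a tape. *)
Definition teq T U :=
  [/\ thead T = thead U,
      forall i, nth None (tleft T) i = nth None (tleft U) i &
      forall i, nth None (tright T) i = nth None (tright U) i].

Lemma teq_trans T U X : teq T U -> teq U X -> teq T X.
Proof.
by case=> a b c [a' b' c']; split=> [|i|i]; rewrite ?a ?b ?c ?a' ?b' ?c'.
Qed.

Lemma teq_write a T U : teq T U -> teq (write_tape a T) (write_tape a U).
Proof. by case. Qed.

Lemma move_right T : move_tape GoRight T =
  Tape (thead T :: tleft T) (nth None (tright T) 0) (behead (tright T)).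
Proof. by case: T => l h []. Qed.

Lemma move_left T : move_tape GoLeft T =
  Tape (behead (tleft T)) (nth None (tleft T) 0) (thead T :: tright T).
Proof. by case: T => -[]. Qed.

Lemma teq_move m T U : teq T U -> teq (move_tape m T) (move_tape m U).
Proof.
case: m => // -[Hh Hl Hr]; rewrite ?move_left ?move_right; split=> //= i;
  rewrite ?nth_behead ?Hh //; by case: i => /=.
Qed.

Lemma bit_prefix_eq (s s' : seq (symbol A)) :
  (forall i, nth None s i = nth None s' i) -> bit_prefix s = bit_prefix s'.
Proof.
elim: s s' => [|a s IH] [|b s'] H //=.
- by move: (H 0) => /= <-.
- by move: (H 0) => /= ->.
- by move: (H 0) => /= ->; rewrite (IH s') // => i; exact: (H i.+1).
Qed.

Lemma teq_output T U : teq T U -> output_tape T = output_tape U.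
Proof. by case=> a b c; apply: bit_prefix_eq => -[|i] /=. Qed.

Definition bitof (a : symbol A) : option bool :=
  if a is Some (inl b) then Some b else None.

(* Tapes are mostly used as stacks of bits, with the head on the top. *)
Definition stk l : tape A := input_tape A l.

Lemma bitof_stk l : bitof (thead (stk l)) = ohead l.
Proof. by case: l. Qed.

Lemma output_stk l : output_tape (stk l) = l.
Proof. by case: l => //= b s; congr cons; elim: s => //= a s ->. Qed.

Lemma teq_push b l :
  teq (write_tape (Some (inl b)) (move_tape GoLeft (stk l))) (stk (b :: l)).
Proof. by case: l => [|a l]; split=> //= -[|[|i]]. Qed.

(** Popping an empty stack has no visible effect. [tick_tm] relies on this when the carry runs past
    the last bit. *)
Lemma teq_pop l :
  teq (move_tape GoRight (write_tape None (stk l))) (stk (behead l)).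
Proof. by case: l => [|a [|b l]]; split=> //= -[|[|i]]. Qed.

End Tapes.

Arguments stk A l : simpl never.

(** * Combinators for multi-tape machines, with time-bounded triples *)

Section Machines.
Variables (A : finType) (K : nat).

Definition reading := {ffun 'I_K.+1 -> symbol A}.
Definition action := {ffun 'I_K.+1 -> symbol A * direction}.

(** A [machine] whose alphabet and number of tapes are parameters, so that machines over the same
    tapes can be composed. *)
Record tm := TM {
  tst : finType;
  tini : tst;
  thlt : pred tst;
  ttr : tst -> reading -> tst * action }.

Definition machine_of (M : tm) : machine :=
  @Machine (tst M) A K (tini M) (@thlt M) (@ttr M).

(** Indexed by all naturals so that tapes are named by numerals; only the indices up to [K] are
    represented by actual tapes. *)
Definition store := nat -> tape A.
Implicit Types (s : store) (M N : tm) (r : reading).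

Definition upd s i T : store := fun j => if j == i then T else s j.

Lemma updE s i T : upd s i T i = T. Proof. by rewrite /upd eqxx. Qed.
Lemma updN s i j T : j != i -> upd s i T j = s j.
Proof. by rewrite /upd => /negbTE ->. Qed.

Definition rep (T : 'I_K.+1 -> tape A) s := forall i, teq (T i) (s i).

Definition reads s : reading := [ffun i : 'I_K.+1 => thead (s i)].

Lemma rep_reads T s : rep T s -> [ffun i => thead (T i)] = reads s.
Proof. by move=> H; apply/ffunP=> i; rewrite !ffunE; case: (H i). Qed.

Definition reach M q T n (Q : tst M -> ('I_K.+1 -> tape A) -> Prop) :=
  exists2 k, k <= n &
    let C := iter k (@step (machine_of M)) (@Config (machine_of M) q T) in
    Q (cstate C) (ctape C).

Lemma reach0 M q T n Q : Q q T -> reach (M := M) q T n Q.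
Proof. by exists 0. Qed.

Lemma reach_trans M q T n m Q Q' : reach (M := M) q T n Q ->
  (forall q' T', Q q' T' -> reach q' T' m Q') -> reach q T (n + m) Q'.
Proof.
case=> k kn H HQ; case: (HQ _ _ H) => j jm; set C := iter k _ _ in H *.
rewrite (_ : Config _ _ = C); last by case: C {H}.
move=> H'; exists (j + k); first by rewrite addnC leq_add.
by rewrite iterD.
Qed.

Lemma reach_step M q T n Q :
  ~~ thlt q ->
  (let: (q', w) := ttr q [ffun i => thead (T i)] in
   reach (M := M) q' (fun i => move_tape (w i).2 (write_tape (w i).1 (T i))) n Q) ->
  reach q T n.+1 Q.
Proof.
move=> Hq H.
suff E : @step (machine_of M) (@Config (machine_of M) q T) =
   let: (q', w) := ttr q [ffun i => thead (T i)] in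
   @Config (machine_of M) q'
     (fun i => move_tape (w i).2 (write_tape (w i).1 (T i))).
  move: E H; case: (ttr _ _) => q' w E [k kn H].
  by exists k.+1 => //; rewrite iterSr E.
by rewrite /step /= (negbTE Hq).
Qed.

(** A Hoare triple with a time bound. The initial tapes are arbitrary up to [teq], since an earlier
    machine may have left recorded blanks. *)
Definition runs M s n s' := forall T, rep T s ->
  reach (M := M) (tini M) T n (fun q T' => thlt q /\ rep T' s').

Lemma runs_ext M s n s' n' s'' : runs M s n s' -> n <= n' ->
  (forall i, i <= K -> s' i = s'' i) -> runs M s n' s''.
Proof.
move=> H nn E T /H [k kn [Hq HT]]; exists k; first exact: leq_trans nn.
by split=> // i; rewrite -E //; exact: ltn_ord i.
Qed.

Lemma runs_eq M s1 s2 n s' : s1 =1 s2 -> runs M s2 n s' -> runs M s1 n s'.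
Proof. by move=> E H T HT; apply: H => i; rewrite -E. Qed.

(** Only the nonhalting states of [M] have to be simulated: a composite machine takes over exactly
    where its component halts. *)
Lemma sim_reach M N (f : tst M -> tst N) :
  (forall q r, ~~ thlt q -> ~~ thlt (f q) /\
     ttr (f q) r = (f (ttr q r).1, (ttr q r).2)) ->
  forall n q T Q, reach q T n (fun q T => thlt q /\ Q q T) ->
  reach (f q) T n (fun p T => exists2 q, p = f q & thlt q /\ Q q T).
Proof.
move=> Hf n q T Q [k kn H].
elim: k n q T kn H => [|k IH] n q T kn H; first by apply: reach0; exists q.
have [hq|nhq] := boolP (thlt q).
  have E : forall j, iter j (@step (machine_of M)) (@Config (machine_of M) q T)
      = @Config (machine_of M) q T.
    by elim=> //= j ->; rewrite /step /= hq.
  by move: H; rewrite E => H; apply: IH (ltnW kn) _; rewrite E.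
case: n kn => // n kn; rewrite iterSr /step /= (negbTE nhq) in H.
have [nhf Ef] := Hf q [ffun i => thead (T i)] nhq.
by apply: reach_step; rewrite // Ef; case: (ttr _ _) H => q' w H; apply: IH.
Qed.

Definition idle r : action := [ffun i => (r i, Stay)].

Lemma rep_idle T s r : rep T s -> r = [ffun i => thead (T i)] ->
  rep (fun i => move_tape (idle r i).2 (write_tape (idle r i).1 (T i))) s.
Proof.
move=> H -> i; rewrite /idle !ffunE /=; apply: teq_trans (H i).
by case: (T i).
Qed.

Definition act (f : reading -> action) : tm :=
  @TM bool false id (fun _ r => (true, f r)).

Lemma runs_act f s :
  runs (act f) s 1 (fun i => if insub i is Some j then
    move_tape (f (reads s) j).2 (write_tape (f (reads s) j).1 (s i)) else s i).
Proof.
move=> T HT; apply: reach_step => //=; apply: reach0; split=> // i.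
rewrite valK (rep_reads HT).
by apply/teq_move/teq_write.
Qed.

Definition seqm M N : tm :=
  @TM (tst M + tst N)%type (inl (tini M))
    (fun q => if q is inr q then thlt q else false)
    (fun q r => match q with
       | inl q => if thlt q then (inr (tini N), idle r)
                  else (inl (ttr q r).1, (ttr q r).2)
       | inr q => (inr (ttr q r).1, (ttr q r).2)
       end).

Lemma runs_seq M N s1 n1 s2 n2 s3 : runs M s1 n1 s2 -> runs N s2 n2 s3 ->
  runs (seqm M N) s1 (n1 + n2.+1) s3.
Proof.
move=> H1 H2 T /H1 HT.
have := @sim_reach M (seqm M N) inl _ _ _ _ _ HT.
case=> [q r /negbTE /= -> //|k kn [q E [hq HT']]].
apply: (@reach_trans (seqm M N) _ _ n1 n2.+1
   (fun p T => exists2 q, p = inl q & thlt q /\ rep T s2)).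
  by exists k => //; exists q.
move=> p T1 [q' -> [hq' HT1]]; apply: reach_step => //=; rewrite hq'.
set T2 := fun i => _; have /H2 HT2 : rep T2 s2 by apply: rep_idle.
have := @sim_reach N (seqm M N) inr _ _ _ _ _ HT2.
case=> [q2 r nh //|j jn [q2 E2 H]].
by exists j => //; move: E2 => /= ->.
Qed.

Definition ite (P : reading -> bool) M N : tm :=
  @TM (option (tst M + tst N))%type None
    (fun q => match q with
       | Some (inl q) => thlt q | Some (inr q) => thlt q | None => false end)
    (fun q r => match q with
       | None => (Some (if P r then inl (tini M) else inr (tini N)), idle r)
       | Some (inl q) => (Some (inl (ttr q r).1), (ttr q r).2)
       | Some (inr q) => (Some (inr (ttr q r).1), (ttr q r).2)
       end).

Lemma runs_ite (P : reading -> bool) M N s n s' :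
  (if P (reads s) then runs M s n s' else runs N s n s') ->
  runs (ite P M N) s n.+1 s'.
Proof.
move=> H T HT; apply: reach_step => //=; rewrite (rep_reads HT).
set T2 := fun i => _.
have HT2 : rep T2 s by apply: rep_idle => //; rewrite (rep_reads HT).
case: (P _) H => /(_ _ HT2) H.
  have := @sim_reach M (ite P M N) (fun q => Some (inl q)) _ _ _ _ _ H.
  by case=> [q2 r nh //|j jn [q2 E2 H']]; exists j => //; move: E2 => /= ->.
have := @sim_reach N (ite P M N) (fun q => Some (inr q)) _ _ _ _ _ H.
by case=> [q2 r nh //|j jn [q2 E2 H']]; exists j => //; move: E2 => /= ->.
Qed.

Definition while (P : reading -> bool) M : tm :=
  @TM (option (option (tst M))) (Some None) (fun q => q == None)
    (fun q r => match q with
       | None => (None, idle r)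
       | Some None => ((if P r then Some (Some (tini M)) else None), idle r)
       | Some (Some q) => if thlt q then (Some None, idle r)
                          else (Some (Some (ttr q r).1), (ttr q r).2)
       end).

Lemma runs_while0 (P : reading -> bool) M s : ~~ P (reads s) -> runs (while P M) s 1 s.
Proof.
move=> H T HT; apply: reach_step => //=; rewrite (rep_reads HT) (negbTE H).
by apply: reach0; split=> //; apply: rep_idle => //; rewrite (rep_reads HT).
Qed.

Lemma runs_whileS (P : reading -> bool) M s n1 s1 n2 s2 : P (reads s) -> runs M s n1 s1 ->
  runs (while P M) s1 n2 s2 -> runs (while P M) s (n1 + n2.+1).+1 s2.
Proof.
move=> HP H1 H2 T HT; apply: reach_step => //=; rewrite (rep_reads HT) HP.
set T1 := fun i => _.
have /H1 HT1 : rep T1 s by apply: rep_idle => //; rewrite (rep_reads HT).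
have := @sim_reach M (while P M) (fun q => Some (Some q)) _ _ _ _ _ HT1.
case=> [q r /negbTE /= -> //|k kn [q E [hq HT']]].
apply: (@reach_trans (while P M) _ _ n1 n2.+1
   (fun p T => exists2 q, p = Some (Some q) & thlt q /\ rep T s1)).
  by exists k => //; exists q.
move=> p T2 [q' -> [hq' HT2]]; apply: reach_step => //=; rewrite hq'.
set T3 := fun i => _; have /H2 HT3 : rep T3 s1 by apply: rep_idle.
by [].
Qed.

End Machines.

Section StackOps.
Variables (A : finType) (K : nat).
Notation store := (store A).
Notation tm := (tm A K).
Notation reading := (reading A K).
Implicit Types (s : store) (l m : bits).

Definition act1 (r : nat) (g : symbol A -> symbol A * direction) : tm :=
  act (fun f : reading => [ffun i : 'I_K.+1 =>
         if val i == r then g (f i) else (f i, Stay)]).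

Lemma runs_act1 s r g T :
  teq (move_tape (g (thead (s r))).2 (write_tape (g (thead (s r))).1 (s r))) T ->
  runs (act1 r g) s 1 (upd s r T).
Proof.
move=> HT U HU0; rewrite /act1; set f := fun _ : reading => _.
have [k kn [Hq HU]] := @runs_act A K f s U HU0.
exists k => //; split=> // i; apply: teq_trans (HU i) _.
rewrite valK !ffunE /upd; case: eqP => [->|_] //=; by case: (s i).
Qed.

Definition push r b : tm :=
  seqm (act1 r (fun a => (a, GoLeft))) (act1 r (fun=> (Some (inl b), Stay))).

Definition pop r : tm := act1 r (fun=> (None, GoRight)).

Lemma runs_push r b s l : s r = stk A l ->
  runs (push r b) s 3 (upd s r (stk A (b :: l))).
Proof.
move=> E; apply: (@runs_ext _ _ _ _ 3
  (upd (upd s r (move_tape GoLeft (s r))) r (stk A (b :: l)))) => //.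
  apply: (@runs_seq _ _ _ _ _ 1 (upd s r (move_tape GoLeft (s r))) 1).
    by apply: runs_act1; apply: (@teq_move _ GoLeft); case: (s r).
  by apply: runs_act1; rewrite updE E; exact: teq_push.
by move=> i _; rewrite /upd; case: eqP.
Qed.

Lemma runs_pop r s l : s r = stk A l ->
  runs (pop r) s 1 (upd s r (stk A (behead l))).
Proof. by move=> E; apply: runs_act1; rewrite E; exact: teq_pop. Qed.

Definition top (f : reading) r : option bool :=
  if insub r is Some i then bitof (f i) else None.

Lemma top_tape s r : r <= K -> top (reads K s) r = bitof (thead (s r)).
Proof. by move=> rK; rewrite /top insubT ffunE. Qed.

Lemma top_reads s r l : r <= K -> s r = stk A l -> top (reads K s) r = ohead l.
Proof. by move=> rK E; rewrite top_tape // E bitof_stk. Qed.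

Definition skip : tm := act (fun f => [ffun i => (f i, Stay)]).

Lemma runs_skip s : runs skip s 1 s.
Proof.
move=> U HU0; rewrite /skip; set f := fun _ : reading => _.
have [k kn [Hq HU]] := @runs_act A K f s U HU0.
exists k => //; split=> // i; apply: teq_trans (HU i) _.
by rewrite valK !ffunE /=; case: (s i).
Qed.

Definition mv r q : tm :=
  seqm (ite (fun f => top f r == Some true) (push q true) (push q false)) (pop r).

Lemma runs_mv r q s b l m : r <= K -> r != q ->
  s r = stk A (b :: l) -> s q = stk A m ->
  runs (mv r q) s 8 (upd (upd s q (stk A (b :: m))) r (stk A l)).
Proof.
move=> rK rq Er Eq; apply: (@runs_ext _ _ _ _ (4 + 2) _ _ _
  (runs_seq (n1:=4) (n2:=1) (s2:=upd s q (stk A (b :: m))) _ _)) => //.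
  apply: runs_ite; rewrite (top_reads _ Er) //.
  by case: b {Er}; exact: runs_push.
by apply: (@runs_pop _ _ (b :: l)); rewrite updN.
Qed.

End StackOps.

Ltac lk := rewrite /upd; repeat first
  [ rewrite eqxx
  | match goal with
    | H : is_true (?a != ?b) |- context [?a == ?b] => rewrite (negbTE H)
    | H : is_true (?a != ?b) |- context [?b == ?a] =>
        rewrite (eq_sym b a) (negbTE H)
    end].

Ltac fin_upd := let i := fresh "i" in
  move=> i _; rewrite /upd; repeat (case: eqP => [?|_]; subst => //=).

(** * Loops on stacks of bits, and random access by a unary index *)

Section Routines.
Variables (A : finType) (K : nat).
Notation store := (store A).
Notation tm := (tm A K).
Notation reading := (reading A K).
Notation stk := (stk A).
Implicit Types (s : store) (l m : bits).

Definition nonempty r (f : reading) := top f r != None.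

Lemma nonempty_reads s r l : r <= K -> s r = stk l ->
  nonempty r (reads K s) = (l != [::]).
Proof. by move=> rK E; rewrite /nonempty (top_reads rK E); case: l {E}. Qed.

Definition move_all r q : tm := while (nonempty r) (mv A K r q).

Lemma runs_move_all r q s l m : r <= K -> r != q ->
  s r = stk l -> s q = stk m ->
  runs (move_all r q) s (10 * size l + 1)
    (upd (upd s q (stk (rev l ++ m))) r (stk [::])).
Proof.
move=> rK rq; elim: l m s => [|b l IH] m s Er Eq.
  apply: (@runs_ext _ _ _ s 1 s) => // [|i _].
    by apply: runs_while0; rewrite (nonempty_reads rK Er).
  rewrite /upd; case: eqP => [->//|_]; by case: eqP => [->|].
apply: runs_ext.
- apply: runs_whileS; first by rewrite (nonempty_reads rK Er).
    exact: runs_mv Er Eq.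
  by apply: (IH (b :: m)); lk.
- by rewrite /=; lia.
- move=> i _; rewrite /upd; case: eqP => // _; case: eqP => // _.
  by rewrite rev_cons -cats1 -catA.
Qed.

Definition clear r : tm := while (nonempty r) (pop A K r).

Lemma runs_clear r s l : r <= K -> s r = stk l ->
  runs (clear r) s (3 * size l + 1) (upd s r (stk [::])).
Proof.
move=> rK; elim: l s => [|b l IH] s Er.
  apply: (@runs_ext _ _ _ s 1 s) => // [|i _].
    by apply: runs_while0; rewrite (nonempty_reads rK Er).
  by rewrite /upd; case: eqP => [->|].
apply: runs_ext.
- apply: runs_whileS; first by rewrite (nonempty_reads rK Er).
    exact: runs_pop Er.
  by apply: IH; rewrite updE.
- by rewrite /=; lia.
- by move=> i _; rewrite /upd; case: eqP.
Qed.

Definition pushes r l : tm := foldl (fun M b => seqm M (push A K r b)) (skip A K) l.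

Lemma runs_pushes r s l m : s r = stk m ->
  runs (pushes r l) s (4 * size l + 1) (upd s r (stk (rev l ++ m))).
Proof.
move=> Er; elim/last_ind: l => [|l b IH].
  apply: (@runs_ext _ _ _ s 1 s) => // [|i _]; first exact: runs_skip.
  by rewrite /upd; case: eqP => [->|].
rewrite /pushes foldl_rcons; apply: runs_ext.
- by apply: runs_seq; [exact: IH|apply: runs_push; rewrite updE].
- by rewrite size_rcons; lia.
- by move=> i _; rewrite /upd rev_rcons; case: eqP.
Qed.

(* [scan z v t] moves [n] symbols from [z] to [t], where [n] is the number held
   in unary by [v]: afterwards the top of [z] is its entry of index [n]. *)
Definition scan z v t : tm :=
  while (fun f => nonempty z f && nonempty v f) (seqm (mv A K z t) (pop A K v)).

Lemma runs_scan z v t s l n r : z <= K -> v <= K -> uniq [:: z; v; t] ->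
  s z = stk l -> s v = stk (nseq n true) -> s t = stk r ->
  runs (scan z v t) s (12 * size l + 1)
    (upd (upd (upd s t (stk (rev (take n l) ++ r))) v
       (stk (nseq (n - size l) true))) z (stk (drop n l))).
Proof.
move=> zK vK /=; rewrite !inE !negb_or => /and3P[/andP[zv zt] vt _].
elim: l n r s => [|b l IH] n r s Ez Ev Et.
  apply: (@runs_ext _ _ _ s 1 s) => // [|i _].
    by apply: runs_while0; rewrite (nonempty_reads zK Ez).
  rewrite /upd /= subn0; case: eqP => [->//|_].
  by case: eqP => [->//|_]; case: eqP => [->|].
case: n Ev => [|n] Ev.
  apply: (@runs_ext _ _ _ s 1 s) => // [|i _].
    by apply: runs_while0; rewrite (nonempty_reads vK Ev) andbF.
  rewrite /upd /=; case: eqP => [->//|_].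
  by case: eqP => [->//|_]; case: eqP => [->|].
apply: runs_ext.
- apply: runs_whileS.
  + by rewrite (nonempty_reads zK Ez) (nonempty_reads vK Ev).
  + apply: runs_seq; first exact: (runs_mv zK zt Ez Et).
    by apply: (@runs_pop _ _ _ _ (nseq n.+1 true)); lk.
  + apply: (IH n (b :: r)).
    * by lk.
    * by lk.
    * by lk.
- by rewrite /=; lia.
- move=> i _; rewrite /upd /= subSS rev_cons cat_rcons.
  by case: eqP => // _; case: eqP => // _; case: eqP.
Qed.

(** Undoes [scan]: each symbol moved back from [t] to [z] returns one mark to [v]. *)
Definition unscan z v t : tm :=
  while (nonempty t) (seqm (mv A K t z) (push A K v true)).

Lemma runs_unscan z v t s l n r : t <= K -> uniq [:: z; v; t] ->
  s z = stk l -> s v = stk (nseq n true) -> s t = stk r ->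
  runs (unscan z v t) s (14 * size r + 1)
    (upd (upd (upd s t (stk [::])) v
       (stk (nseq (size r + n) true))) z (stk (rev r ++ l))).
Proof.
move=> tK /=; rewrite !inE !negb_or => /and3P[/andP[zv zt] vt _].
elim: r n l s => [|b r IH] n l s Ez Ev Et.
  apply: (@runs_ext _ _ _ s 1 s) => // [|i _].
    by apply: runs_while0; rewrite (nonempty_reads tK Et).
  rewrite /upd /=; case: eqP => [->//|_].
  by case: eqP => [->//|_]; case: eqP => [->|].
apply: runs_ext.
- apply: runs_whileS.
  + by rewrite (nonempty_reads tK Et).
  + apply: runs_seq; first by apply: (runs_mv tK _ Et Ez); rewrite eq_sym.
    by apply: (@runs_push _ _ _ _ _ (nseq n true)); lk.
  + apply: (IH n.+1 (b :: l)).
    * by lk.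
    * by lk.
    * by lk.
- by rewrite /=; lia.
- move=> i _; rewrite /upd /= addnS rev_cons cat_rcons.
  by case: eqP => // _; case: eqP => // _; case: eqP.
Qed.

(** The tapes are restored before either branch is entered. With [l] on [z] and [n] on [v], the
    first argument of [P] is [None] when [size l <= n] and the second when [n <= size l]; together
    they test equality. *)
Definition branch (P : option bool -> option bool -> bool) z v t M N : tm :=
  seqm (scan z v t)
    (ite (fun f => P (top f z) (top f v))
      (seqm (unscan z v t) M) (seqm (unscan z v t) N)).

Lemma runs_branch P z v t M N s l n k s' : z <= K -> v <= K -> t <= K ->
  uniq [:: z; v; t] ->
  s z = stk l -> s v = stk (nseq n true) -> s t = stk [::] ->
  (if P (ohead (drop n l)) (ohead (nseq (n - size l) true))
   then runs M s k s' else runs N s k s') ->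
  runs (branch P z v t M N) s (26 * size l + 5 + k) s'.
Proof.
move=> zK vK tK U Ez Ev Et H.
have /= := U; rewrite !inE !negb_or => /and3P[/andP[zv zt] vt _].
apply: runs_ext; first apply: (runs_seq (runs_scan zK vK U Ez Ev Et)).
- apply: (@runs_ite _ _ _ _ _ _ (14 * size l + 1 + k.+1)).
  rewrite (@top_reads _ _ _ _ (drop n l)) //; last by lk.
  rewrite (@top_reads _ _ _ v (nseq (n - size l) true)) //; last by lk.
  set s2 := upd _ _ _.
  have H2 : runs (unscan z v t) s2 (14 * size l + 1) s.
    apply: runs_ext; first apply: (@runs_unscan _ _ _ _ (drop n l)
       (n - size l) (rev (take n l) ++ [::])) => //.
    + by rewrite /s2; lk.
    + by rewrite /s2; lk.
    + by rewrite /s2; lk.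
    + rewrite cats0 size_rev size_take; case: ltnP; lia.
    + move=> i _; rewrite /s2 /upd cats0 revK cat_take_drop size_rev size_take.
      case: eqP => [->//|_]; case: eqP => [->|_]; last first.
        by case: eqP => [->|].
      by rewrite Ev; congr (stk (nseq _ _)); case: ltnP; lia.
  case: (P _ _) H => H.
  + exact: (runs_seq H2 H).
  + exact: (runs_seq H2 H).
- by lia.
- by [].
Qed.

End Routines.

(** * A language of nested loops *)

Fixpoint bits_succ (l : bits) : bits :=
  if l is b :: l' then if b then false :: bits_succ l' else true :: l'
  else [:: true].

Lemma nat_bitsS n : nat_bits n.+1 = odd n.+1 :: nat_bits (n.+1)./2.
Proof.
rewrite /nat_bits up_log2S // /mkseq /= divn1; congr (_ :: _).
rewrite -[1]addn0 iotaDl -map_comp; apply: eq_map => i /=.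
by rewrite expnS divnMA divn2.
Qed.

Lemma nat_bits_succ n : nat_bits n.+1 = bits_succ (nat_bits n).
Proof.
elim/ltn_ind: n => -[_|n IH]; first by rewrite nat_bitsS.
rewrite [in RHS]nat_bitsS nat_bitsS /= negbK; case: (boolP (odd n)) => o /=.
  by congr (_ :: nat_bits _); rewrite uphalfE /= ; have := odd_double_half n; lia.
by rewrite -IH; [congr (_ :: nat_bits _)|]; rewrite ?uphalfE; have := odd_double_half n; lia.
Qed.

Lemma size_nat_bits n : size (nat_bits n) <= n.
Proof.
elim/ltn_ind: n => -[|n] IH; first by rewrite /nat_bits size_mkseq.
rewrite nat_bitsS /=; apply: (leq_ltn_trans (IH _ _)); rewrite ?uphalfE; lia.
Qed.

Lemma nseq_catS (T : Type) n (x : T) l : nseq n x ++ x :: l = x :: nseq n x ++ l.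
Proof. by elim: n => //= n ->. Qed.

(** The shape in which [tick_tm] works: its two loops turn the leading ones into zeros, and [behead]
    drops the zero that receives the carry, if there is one. *)
Lemma bits_succP l : exists k l', [/\ l = nseq k true ++ l',
  ohead l' != Some true & bits_succ l = nseq k false ++ true :: behead l'].
Proof.
elim: l => [|[] l [k [l' [E1 H E2]]]] /=; first by exists 0, [::].
  by exists k.+1, l'; rewrite {1}E1 E2.
by exists 0, (false :: l).
Qed.

Lemma size_delimit x : size (delimit x) = (size x).*2.+1.
Proof. by rewrite /delimit size_rcons; congr _.+1; elim: x => //= b x ->. Qed.

(* Variables are numbered by depth: a loop at depth [d] binds the variable [d],
   and an environment lists the values of the variables in scope.  All loops run
   over [0 .. B - 1].  A program writes bits and owns a counter: [Tick]
   increments it, [EmitC] writes its binary code.  [Eqv o i j] tests whether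
   variable [i] equals variable [j] plus [o], and [Dat k i P] whether [P] holds
   of the entry of the bit string [dat k] indexed by the variable [i]. *)
Inductive test :=
  | Eqv of bool & nat & nat
  | Dat of nat & nat & pred (option bool).

Inductive prog :=
  | Emit of bits
  | EmitC
  | Tick
  | Reset
  | Then of prog & prog
  | For of prog
  | If of test & prog & prog.

Section Semantics.
Variables (dat : nat -> bits) (B : nat).
Implicit Types (env : seq nat) (st : nat * bits) (p : prog).

Definition test_val env (t : test) : bool :=
  match t with
  | Eqv o i j => nth 0 env i == nth 0 env j + o
  | Dat k i P => P (onth (dat k) (nth 0 env i))
  end.

Fixpoint ev p env st : nat * bits :=
  match p with
  | Emit l => (st.1, st.2 ++ l)
  | EmitC => (st.1, st.2 ++ encode_nat st.1)
  | Tick => (st.1.+1, st.2)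
  | Reset => (0, st.2)
  | Then p q => ev q env (ev p env st)
  | For p => foldl (fun st k => ev p (rcons env k) st) st (iota 0 B)
  | If t p q => if test_val env t then ev p env st else ev q env st
  end.

(** Bounds the growth of the counter. Both branches of a test are charged, which makes the bound
    independent of the environment. *)
Fixpoint ticks p : nat :=
  match p with
  | Tick => 1
  | Then p q => ticks p + ticks q
  | For p => B * ticks p
  | If _ p q => ticks p + ticks q
  | _ => 0
  end.

(** [U] is meant to bound the number of rounds, the data strings and the counter all at once. The
    same number also bounds the length of the output. *)
Fixpoint steps p (U : nat) : nat :=
  match p with
  | Emit l => 4 * size l + 1
  | EmitC | Tick | Reset => 40 * U + 40
  | Then p q => steps p U + (steps q U).+1
  | For p => U * (steps p U + 20) + 20 * U + 20
  | If _ p q => 40 * U + 40 + steps p U + steps q U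
  end.

End Semantics.

(** [Eqv] scans the tape of one variable with the other one as index, so the two must differ. *)
Definition test_wf d (t : test) :=
  match t with
  | Eqv _ i j => [&& i < d, j < d & i != j]
  | Dat k i _ => (0 < k < 6) && (i < d)
  end.

(** Depth 8 suffices: a point has at most four indices, and the distances run over pairs of
    points. *)
Fixpoint wf d p :=
  match p with
  | Then p q => wf d p && wf d q
  | For p => (d < 8) && wf d.+1 p
  | If t p q => [&& test_wf d t, wf d p & wf d q]
  | _ => d <= 8
  end.

(* The tapes 1 to 5 hold the data, 6 is scratch, 7 holds the counter in binary,
   8 the output in reverse order, [9 + 2 i] the value of the variable [i] in
   unary, and [10 + 2 i] the number of rounds its loop still has to make. *)
Section Compile.
Variables (A : finType) (K : nat).
Hypothesis K_big : 36 <= K.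
Notation store := (store A).
Notation tm := (tm A K).
Notation reading := (reading A K).
Notation stk := (stk A).
Notation push := (push A K).
Notation pop := (pop A K).
Notation mv := (mv A K).
Implicit Types (s : store) (l m : bits).

Definition succ_loop : tm :=
  while (fun f => top f 7 == Some true) (seqm (pop 7) (push 6 true)).
Definition succ_unwind : tm :=
  while (nonempty 6) (seqm (pop 6) (push 7 false)).
Definition tick_tm : tm :=
  seqm succ_loop (seqm (pop 7) (seqm (push 7 true) succ_unwind)).

Lemma leK i : i <= 36 -> i <= K.
Proof. by move=> H; apply: leq_trans K_big. Qed.

Lemma runs_succ_unwind s n l :
  s 6 = stk (nseq n true) -> s 7 = stk l ->
  runs succ_unwind s (7 * n + 1)
    (upd (upd s 6 (stk [::])) 7 (stk (nseq n false ++ l))).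
Proof.
elim: n l s => [|n IH] l s E6 E7.
  apply: (@runs_ext _ _ _ s 1 s) => //; last by fin_upd.
  by apply: runs_while0; rewrite (nonempty_reads _ E6) // leK.
apply: runs_ext.
- apply: runs_whileS.
  + by rewrite (nonempty_reads _ E6) // leK.
  + apply: runs_seq; first exact: (runs_pop E6).
    by apply: (@runs_push _ _ _ _ _ l); lk.
  + by apply: (IH (false :: l)); lk.
- lia.
- by fin_upd; rewrite nseq_catS.
Qed.

Lemma runs_succ_loop s n k l :
  s 6 = stk (nseq n true) -> s 7 = stk (nseq k true ++ l) ->
  ohead l != Some true ->
  runs succ_loop s (7 * k + 1)
    (upd (upd s 6 (stk (nseq (k + n) true))) 7 (stk l)).
Proof.
move=> + + H; elim: k n s => [|k IH] n s E6 E7.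
  apply: (@runs_ext _ _ _ s 1 s) => //; last by fin_upd.
  by apply: runs_while0; rewrite (top_reads _ E7) // leK.
apply: runs_ext.
- apply: runs_whileS.
  + by rewrite (top_reads _ E7) // leK.
  + apply: runs_seq; first exact: (runs_pop E7).
    by apply: (@runs_push _ _ _ _ _ (nseq n true)); lk.
  + by apply: (IH n.+1); lk.
- lia.
- by fin_upd; rewrite addnS.
Qed.

Lemma runs_tick s l : s 6 = stk [::] -> s 7 = stk l ->
  runs tick_tm s (20 * size l + 20) (upd s 7 (stk (bits_succ l))).
Proof.
case: (bits_succP l) => k [l' [-> H ->]] E6 E7; apply: runs_ext.
- apply: runs_seq; first exact: (@runs_succ_loop _ 0 k l').
  apply: runs_seq; first by apply: (@runs_pop _ _ _ _ l'); lk.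
  apply: runs_seq; first by apply: (@runs_push _ _ _ _ _ (behead l')); lk.
  by apply: (@runs_succ_unwind _ k (true :: behead l')); lk; rewrite ?addn0.
- by rewrite size_cat size_nseq; lia.
- by fin_upd.
Qed.

Definition spell_loop : tm :=
  while (nonempty 7) (seqm (push 8 true) (seqm
    (ite (fun f => top f 7 == Some true) (push 8 true) (push 8 false))
    (mv 7 6))).
Definition spell_tm : tm :=
  seqm spell_loop (seqm (push 8 false) (move_all A K 6 7)).

Lemma runs_spell_loop s l m o :
  s 6 = stk m -> s 7 = stk l -> s 8 = stk o ->
  runs spell_loop s (20 * size l + 1)
    (upd (upd (upd s 7 (stk [::])) 6 (stk (rev l ++ m))) 8
      (stk (rev (flatten [seq [:: true; b] | b <- l]) ++ o))).
Proof.
elim: l m o s => [|b l IH] m o s E6 E7 E8.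
  apply: (@runs_ext _ _ _ s 1 s) => //; last by fin_upd.
  by apply: runs_while0; rewrite (nonempty_reads _ E7) // leK.
apply: runs_ext.
- apply: runs_whileS.
  + by rewrite (nonempty_reads _ E7) // leK.
  + apply: runs_seq; first exact: (runs_push _ E8).
    apply: runs_seq.
      apply: (@runs_ite _ _ _ _ _ _ 3 (upd (upd s 8 (stk (true :: o))) 8
         (stk (b :: true :: o)))).
      rewrite (@top_reads _ _ _ _ (b :: l)) ?leK //.
      by case: b {E7 IH}; apply: runs_push; lk.
    by apply: (@runs_mv _ _ _ _ _ b l m); rewrite ?leK //; lk.
  + by apply: (IH (b :: m) (b :: true :: o)); lk.
- by rewrite /=; lia.
- fin_upd.
  + by rewrite !rev_cons !cat_rcons.
  + by rewrite !rev_cons !cat_rcons.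
Qed.

Lemma runs_spell s l o :
  s 6 = stk [::] -> s 7 = stk l -> s 8 = stk o ->
  runs spell_tm s (30 * size l + 10) (upd s 8 (stk (rev (delimit l) ++ o))).
Proof.
move=> E6 E7 E8; apply: runs_ext.
- apply: runs_seq; first exact: (runs_spell_loop E6 E7 E8).
  apply: runs_seq; first by apply: runs_push; lk.
  by apply: (@runs_move_all _ _ _ _ _ (rev l) [::]); rewrite ?leK //; lk; rewrite ?cats0.
- by rewrite size_rev; lia.
- by fin_upd; rewrite ?revK ?cats0 ?E7 // /delimit rev_rcons.
Qed.

Notation vreg i := (9 + i.*2).
Notation wreg i := (10 + i.*2).

(** The offset 1 of [Eqv] is a mark pushed on the tape of [j] for the comparison; either branch
    begins by removing it. *)
Definition test_tm (t : test) (M N : tm) : tm :=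
  match t with
  | Eqv o i j =>
    let P := fun a b : option bool => (a == None) && (b == None) in
    if o then seqm (push (vreg j) true) (branch P (vreg j) (vreg i) 6
                (seqm (pop (vreg j)) M) (seqm (pop (vreg j)) N))
    else branch P (vreg j) (vreg i) 6 M N
  | Dat k i P => branch (fun a _ => P a) k (vreg i) 6 M N
  end.

(** Each round of a loop moves one mark from the round counter to the variable, so the two always
    share [B] marks; moving them back at the end restores both tapes. *)
Fixpoint compile d p : tm :=
  match p with
  | Emit l => pushes A K 8 l
  | EmitC => spell_tm
  | Tick => tick_tm
  | Reset => clear A K 7
  | Then p q => seqm (compile d p) (compile d q)
  | For p => seqm (while (nonempty (wreg d)) (seqm (compile d.+1 p)
                 (mv (wreg d) (vreg d)))) (move_all A K (vreg d) (wreg d))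
  | If t p q => test_tm t (compile d p) (compile d q)
  end.

Section Correct.
Variables (dat : nat -> bits) (B : nat).

(** A variable out of scope has the value 0, by the default of [nth], and its round counter is full:
    its loop is ready to start. *)
Definition loop_inv env c out s :=
  [/\ s 6 = stk [::], s 7 = stk (nat_bits c), s 8 = stk (rev out),
   forall k, 0 < k < 6 -> s k = stk (dat k) &
   forall i, i < 8 -> s (vreg i) = stk (nseq (nth 0 env i) true) /\
     (size env <= i -> s (wreg i) = stk (nseq B true))].

(** Only the counter and the output change, so the registers of the enclosing loops survive the
    execution of their body. *)
Definition result s (st : nat * bits) :=
  upd (upd s 7 (stk (nat_bits st.1))) 8 (stk (rev st.2)).

Lemma inv_result env c out s st : loop_inv env c out s ->
  loop_inv env st.1 st.2 (result s st).
Proof.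
case=> E6 E7 E8 Ed Ev; split=> [|||k H|i H] //.
  by rewrite /result !updN ?Ed //; lia.
have [Ev1 Ev2] := Ev i H; split=> [|Hi].
  by rewrite /result !updN ?Ev1 //; lia.
by rewrite /result !updN ?Ev2 //; lia.
Qed.

Lemma runs_test t M N env c out s U k s' : loop_inv env c out s ->
  test_wf (size env) t -> size env <= 8 -> B < U ->
  (forall i, 0 < i < 6 -> size (dat i) < U) -> all (fun x => x < B) env ->
  (if test_val dat env t then runs M s k s' else runs N s k s') ->
  runs (test_tm t M N) s (40 * U + 40 + k) s'.
Proof.
case=> E6 E7 E8 Ed Ev Hwf He HB HU Henv H.
case: t Hwf H => [o i j|q i P] /=.
- case/and3P=> Hi Hj ij.
  have Hi8 : i < 8 by lia.
  have Hj8 : j < 8 by lia.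
  have [Evi _] := Ev i Hi8; have [Evj _] := Ev j Hj8.
  have jB : nth 0 env j < B by apply/(all_nthP 0 Henv).
  set a := nth 0 env i in Evi *; set b := nth 0 env j in Evj jB *.
  have nij : vreg i != vreg j by lia.
  have tst x y : (ohead (drop x (nseq y true)) == None) &&
     (ohead (nseq (x - size (nseq y true)) true) == None) = (x == y).
    rewrite size_nseq; case: (ltngtP x y) => xy.
    + by rewrite drop_nseq; case E : (y - x) => //; lia.
    + by case E : (x - y) => [|z] /=; [lia|rewrite andbF].
    + by rewrite xy subnn drop_oversize ?size_nseq.
  case: o => H.
  + apply: runs_ext.
    * apply: runs_seq; first exact: (runs_push _ Evj).
      apply: (@runs_branch _ _ _ _ _ _ _ _ _ (nseq b.+1 true) a (2 + k)).
      - by apply: leK; lia.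
      - by apply: leK; lia.
      - by apply: leK; lia.
      - by rewrite /= !inE; lia.
      - by lk.
      - by lk.
      - by rewrite updN //; lia.
      - rewrite tst -addn1.
        have Hp : runs (pop (vreg j)) (upd s (vreg j) (stk (true :: nseq b true))) 1 s.
          apply: runs_ext; first by apply: (@runs_pop _ _ _ _ (nseq b.+1 true)); lk.
          + by [].
          + by fin_upd.
        case: (a == b + 1) H => H.
          by apply: runs_ext; [apply: runs_seq Hp H|lia|].
        by apply: runs_ext; [apply: runs_seq Hp H|lia|].
    * by rewrite size_nseq; lia.
    * by [].
  + apply: runs_ext.
    * apply: (@runs_branch _ _ _ _ _ _ _ _ _ (nseq b true) a k).
      - by apply: leK; lia.
      - by apply: leK; lia.
      - by apply: leK; lia.
      - by rewrite /= !inE; lia.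
      - by [].
      - by [].
      - by [].
      - by rewrite tst -[b]addn0; exact: H.
    * by rewrite size_nseq; lia.
    * by [].
- case/andP=> Hq Hi H.
  have Hi8 : i < 8 by lia.
  have [Evi _] := Ev i Hi8; have qU := HU q Hq.
  set a := nth 0 env i in Evi H *.
  apply: runs_ext.
  + apply: (@runs_branch _ _ _ _ _ _ _ _ _ (dat q) a k).
    * by apply: leK; lia.
    * by apply: leK; lia.
    * by apply: leK; lia.
    * by rewrite /= !inE; lia.
    * exact: Ed.
    * by [].
    * by [].
    * suff <- : onth (dat q) a = ohead (drop a (dat q)) by exact: H.
      by elim: (dat q) (a) => [|x l IH] [|n] //=.
  + by lia.
  + by [].
Qed.

Lemma wf_depth d p : wf d p -> d <= 8.
Proof.
by elim: p d => //= [p IH q _|p _|t p IH q _] d;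
  [case/andP=> /IH|case/andP=> /ltnW|case/and3P=> _ /IH].
Qed.

Variable U : nat.
Hypotheses (BU : B < U) (datU : forall k, 0 < k < 6 -> size (dat k) < U).

(** The bounds are proved along with the run because the cost of [Tick], [Reset] and [EmitC] depends
    on the counter reached so far. *)
Theorem compile_ok p env c out s :
  wf (size env) p -> loop_inv env c out s -> all (fun x => x < B) env ->
  c + ticks B p <= U ->
  let st := ev dat B p env (c, out) in
  [/\ st.1 <= c + ticks B p, size st.2 <= size out + steps p U &
      runs (compile (size env) p) s (steps p U) (result s st)].
Proof.
elim: p env c out s => [l||||p IHp q IHq|p IH|t p IHp q IHq] env c out s /=;
    move=> Hwf Hinv Henv Hc; have [E6 E7 E8 Ed Ev] := Hinv.
- rewrite addn0 size_cat; split=> //; first lia.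
  apply: runs_ext; first exact: (runs_pushes _ E8); first lia.
  by rewrite /result; fin_upd; rewrite rev_cat.
- have Hs := size_nat_bits c.
  rewrite addn0 size_cat /encode_nat size_delimit; split=> //; first lia.
  apply: runs_ext; first exact: (runs_spell E6 E7 E8); first lia.
  by rewrite /result; fin_upd; rewrite rev_cat.
- have Hs := size_nat_bits c.
  split; [lia|lia|].
  apply: runs_ext; first exact: (runs_tick E6 E7); first lia.
  by rewrite /result; fin_upd; rewrite nat_bits_succ.
- have Hs := size_nat_bits c.
  split; [lia|lia|].
  apply: runs_ext; first exact: (runs_clear (leK _) E7); first lia.
  by rewrite /result; fin_upd.
- case/andP: Hwf => wp wq.
  have [|c1 o1 r1] := IHp env c out s wp Hinv Henv; first lia.
  set st := ev dat B p env (c, out) in c1 o1 r1 *.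
  have [|c2 o2 r2] := IHq env st.1 st.2 (result s st) wq (inv_result st Hinv) Henv.
    by lia.
  rewrite -surjective_pairing in c2 o2 r2.
  split; [lia|lia|].
  apply: runs_ext; first apply: (runs_seq r1 r2); first by [].
  by rewrite /result; fin_upd.
- case/andP: Hwf => d8 wp; set d := size env in d8 wp *.
  have [Evd Ewd] := Ev d d8.
  have Evd0 : nth 0 env d = 0 by rewrite nth_default.
  (* The loop is followed from round [k] on, with [j] rounds left on the round counter and [k] marks
     on the variable. *)
  have loop j k st : k + j = B -> st.1 + j * ticks B p <= U ->
    let st' := foldl (fun st k => ev dat B p (rcons env k) st) st (iota k j) in
    [/\ st'.1 <= st.1 + j * ticks B p, size st'.2 <= size st.2 + j * steps p U &
     runs (while (nonempty (wreg d)) (seqm (compile d.+1 p)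
                 (mv (wreg d) (vreg d))))
      (upd (upd (result s st) (wreg d) (stk (nseq j true))) (vreg d)
         (stk (nseq k true)))
      (j * (steps p U + 13) + 1)
      (upd (upd (result s st') (wreg d) (stk [::])) (vreg d)
         (stk (nseq B true)))].
    elim: j k st => [|j IHj] k st kj cU.
      rewrite !mul0n !addn0; rewrite addn0 in kj; subst k; split=> //=.
      apply: runs_while0; rewrite (@nonempty_reads _ _ _ _ [::]) //.
        by apply: leK; lia.
      by rewrite updN ?updE //; lia.
    set s1 := upd (upd _ _ _) _ _.
    have Hinv1 : loop_inv (rcons env k) st.1 st.2 s1.
      split; try by rewrite /s1 !updN //; lia.
      - by move=> q Hq; rewrite /s1 /result !updN ?Ed //; lia.
      - move=> i Hi; rewrite size_rcons nth_rcons; split=> [|Hi2].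
          have [->|ne] := eqVneq i d; first by rewrite /s1 updE ltnn.
          rewrite /s1 /result !updN; [|lia|lia|lia|lia].
          have [-> _] := Ev i Hi; case: ltnP => // ge.
          by rewrite nth_default.
        rewrite /s1 /result !updN; [|lia|lia|lia|lia].
        by have [_ ->] := Ev i Hi; last lia.
    have [||||c1 o1 r1] := IH (rcons env k) st.1 st.2 s1.
    - by rewrite size_rcons.
    - by [].
    - by rewrite all_rcons Henv andbT; lia.
    - by lia.
    rewrite -surjective_pairing size_rcons in c1 o1 r1.
    set st1 := ev dat B p (rcons env k) st in c1 o1 r1.
    have [||c2 o2 r2] := IHj k.+1 st1; [by lia|by lia|].
    rewrite /= -/st1; split; [by lia|by lia|].
    apply: runs_ext.
    - apply: runs_whileS.
      + rewrite (@nonempty_reads _ _ _ _ (nseq j.+1 true)) //.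
          by apply: leK; lia.
        by rewrite /s1 updN ?updE //; lia.
      + apply: (runs_seq r1).
        apply: (@runs_mv _ _ _ _ _ true (nseq j true) (nseq k true)).
        * by apply: leK; lia.
        * by lia.
        * by rewrite /result /s1 updN; [rewrite updN; [rewrite updN; [rewrite updE|lia]|lia]|lia].
        * by rewrite /result updN; [rewrite updN; [rewrite /s1 updE|lia]|lia].
      + apply: (@runs_ext _ _ _ _ _ _ _ _ _ (leqnn _) (fun i _ => erefl _)).
        have E : upd (upd (result s1 st1) (vreg d) (stk (true :: nseq k true)))
           (wreg d) (stk (nseq j true)) =1
           upd (upd (result s st1) (wreg d) (stk (nseq j true))) (vreg d)
             (stk (nseq k.+1 true)).
          move=> i; rewrite /s1 /result /upd.
          case: (eqVneq i (wreg d)) => [->|nw].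
            by rewrite (_ : _ == vreg d = false) //; apply/eqP; lia.
          case: (eqVneq i (vreg d)) => // nv.
          by case: eqP => // _; case: eqP.
        exact: (runs_eq E r2).
    - by lia.
    - by [].
  have [|c2 o2 r2] := loop B 0 (c, out) erefl; first by [].
  move: c2 o2 r2; rewrite -[(c, out).1]/c -[(c, out).2]/out => c2 o2 r2.
  set st' := foldl _ _ _ in c2 o2 r2 *.
  split; [by []|by have := leq_mul2r (steps p U) B U; lia|].
  apply: runs_ext.
  + apply: runs_seq.
      apply: runs_eq r2 => i; rewrite /result /upd /=.
      case: (eqVneq i (vreg d)) => [->|nv]; first by rewrite Evd Evd0.
      case: (eqVneq i (wreg d)) => [->|nw]; first by rewrite Ewd.
      by case: eqP => [->//|_]; case: eqP => [->|].
    apply: (@runs_move_all _ _ _ _ _ (nseq B true) [::]).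
    * by apply: leK; lia.
    * by lia.
    * by rewrite updE.
    * by rewrite updN ?updE //; lia.
  + rewrite size_nseq; have := leq_mul2r (steps p U + 13) B U; lia.
  + move=> i _; rewrite /result /upd.
    case: (eqVneq i (vreg d)) => [->|nv].
      rewrite (_ : _ == 8 = false); last by apply/eqP; lia.
      rewrite (_ : _ == 7 = false); last by apply/eqP; lia.
      by rewrite Evd Evd0.
    case: (eqVneq i (wreg d)) => [->|nw] //.
    rewrite (_ : _ == 8 = false); last by apply/eqP; lia.
    rewrite (_ : _ == 7 = false); last by apply/eqP; lia.
    by rewrite Ewd // cats0 rev_nseq.
- case/and3P: Hwf => wt wp wq.
  have d8 := wf_depth wp.
  have [|c1 o1 r1] := IHp env c out s wp Hinv Henv; first lia.
  have [|c2 o2 r2] := IHq env c out s wq Hinv Henv; first lia.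
  split; [by case: ifP; lia|by case: ifP; lia|].
  apply: runs_ext.
  + apply: (runs_test (k := steps p U + steps q U) Hinv wt d8 BU datU Henv
       (s' := result s (if test_val dat env t then ev dat B p env (c, out)
                        else ev dat B q env (c, out)))).
    case: (test_val dat env t).
      by apply: runs_ext r1 _ _ => //; lia.
    by apply: runs_ext r2 _ _ => //; lia.
  + by lia.
  + by [].
Qed.

End Correct.

End Compile.

(** * The tableau of a verifier as a constraint problem *)

(** Whatever depends on the finite data of the verifier is a constant [BC], resolved while the
    program is built; only positions and data bits are tested at run time. *)
Inductive bexp :=
  | BT of test
  | BC of bool
  | BN of bexp
  | BA of bexp & bexp
  | BO of bexp & bexp.

Fixpoint beval dat env (b : bexp) : bool :=
  match b with
  | BT t => test_val dat env t
  | BC c => c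
  | BN a => ~~ beval dat env a
  | BA a b => beval dat env a && beval dat env b
  | BO a b => beval dat env a || beval dat env b
  end.

Fixpoint bexp_wf d (b : bexp) : bool :=
  match b with
  | BT t => test_wf d t
  | BC c => true
  | BN a => bexp_wf d a
  | BA a b => bexp_wf d a && bexp_wf d b
  | BO a b => bexp_wf d a && bexp_wf d b
  end.

Fixpoint cond (b : bexp) (p q : prog) : prog :=
  match b with
  | BT t => If t p q
  | BC c => if c then p else q
  | BN a => cond a q p
  | BA a b => cond a (cond b p q) q
  | BO a b => cond a p (cond b p q)
  end.

Arguments cond : simpl never.

Lemma ev_cond dat B b p q env st :
  ev dat B (cond b p q) env st =
  if beval dat env b then ev dat B p env st else ev dat B q env st.
Proof.
elim: b p q => [//|[]//|a IH|a IHa b IHb|a IHa b IHb] p q; rewrite /cond -/cond /=.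
- by rewrite IH if_neg.
- by rewrite IHa IHb; case: beval.
- by rewrite IHa IHb; case: beval.
Qed.

Lemma wf_cond d b p q : bexp_wf d b -> wf d p -> wf d q -> wf d (cond b p q).
Proof.
elim: b p q => [t|[]//|a IH|a IHa b IHb|a IHa b IHb] p q;
  rewrite /cond -/cond /=.
- by move=> -> -> ->.
- by move=> *; apply: IH.
- by case/andP=> wa wb wp wq; apply: IHa => //; apply: IHb.
- by case/andP=> wa wb wp wq; apply: IHa => //; apply: IHb.
Qed.

(** * Cells and clauses of the tableau *)

Section Tableau.
Variable M : machine.
Notation Q := (mstate M).
Notation A := (maux M).
Notation tapes := ('I_(mtapes M).+1).

(** [None] is the state, repeated at every position; [Some (j, side)] is one half of tape [j], and
    the half [true] begins with the scanned cell. *)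
Definition kind : finType := option (tapes * bool)%type.
Definition value : finType := (Q + symbol A)%type.
Definition view : finType := (Q * {ffun tapes -> symbol A})%type.
Definition rule : finType := option (option (kind + view * kind * value))%type.

Implicit Types (C : config M) (k : kind) (w a : value) (v : view).

Definition tcell (T : tape A) (side : bool) i : symbol A :=
  if side then nth None (thead T :: tright T) i else nth None (tleft T) i.

Definition cellval C k i : value :=
  match k with
  | None => inl (cstate C)
  | Some (j, side) => inr (tcell (ctape C j) side i)
  end.

(** A halted configuration rewrites what it reads, so one kind of clause covers all steps, also
    those after halting. *)
Definition outcome v : Q * {ffun tapes -> symbol A * direction} :=
  if mhalt v.1 then (v.1, [ffun j => (v.2 j, Stay)]) else mtrans v.1 v.2.

Definition view_of C : view := (cstate C, [ffun j => thead (ctape C j)]).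

Lemma cellval_step C k i : cellval (step C) k i =
  match k with
  | None => inl (outcome (view_of C)).1
  | Some (j, side) => let w := (outcome (view_of C)).2 j in
      inr (tcell (move_tape w.2 (write_tape w.1 (ctape C j))) side i)
  end.
Proof.
rewrite /step /outcome /view_of /=; case: (mhalt _) => /=.
  by case: k => // -[j side] /=; rewrite !ffunE /=; case: (ctape C j).
by case: (mtrans _ _) => q w; case: k => [[]|].
Qed.

(* Tapes are described relatively to their heads, so a move shifts all cells.
   [written m side i]: the cell is the one just written before the move [m];
   [source m side i side' i']: it held the position [(side', i')]. *)
Definition written m (side : bool) i :=
  match m with
  | Stay => side && (i == 0)
  | GoRight => ~~ side && (i == 0)
  | GoLeft => side && (i == 1)
  end.

Definition source m (side : bool) i : bool * nat :=
  match m with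
  | Stay => (side, i)
  | GoRight => if side then (true, i.+1)
               else if i == 0 then (true, 0) else (false, i.-1)
  | GoLeft => if side then if i == 0 then (false, 0) else (true, i.-1)
              else (false, i.+1)
  end.

Lemma tcell_move m b (T : tape A) side i :
  tcell (move_tape m (write_tape b T)) side i =
  if written m side i then b
  else tcell T (source m side i).1 (source m side i).2.
Proof.
case: m; rewrite ?move_left ?move_right /tcell.
- by case: side => /=; rewrite ?nth_behead //; case: i => [|[|i]].
- by case: side; case: i.
- by case: side => /=; case: i => [|i] //=; rewrite ?nth_behead.
Qed.

Definition input_kind : kind := Some (ord0, true).
Definition blank : value := inr None.
Definition bit b : value := inr (Some (inl b)).

Section Clauses.
(* The indices of the loop variables holding the position [(t, i)] of a clause
   and the position [(t', i')] of a cell. *)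
Variables t i t' i' : nat.

Definition beq x y := BT (Eqv false x y).
Definition bsucc x y := BT (Eqv true x y).
(** [dat 5] will be [[:: true; false]], whose entries tell the indices 0 and 1 from each other and
    from all others. *)
Definition bzero x := BT (Dat 5 x (fun o => o == Some true)).
Definition bone x := BT (Dat 5 x (fun o => o == Some false)).

(** The input tape must begin with [dat 1]; the cells after it, below the length of [dat 2], may
    hold any bit or a blank. This is where the certificate is guessed. *)
Definition allowed_x k w : bexp :=
  match k with
  | None => BC (w == inl (mstart M))
  | Some (j, side) =>
    if (j == ord0) && side then
      BO (BT (Dat 1 i (fun o => if o is Some b then w == bit b else false)))
         (BA (BT (Dat 1 i (fun o => o == None)))
             (BO (BC (w == blank))
                 (BA (BC ((w == bit true) || (w == bit false)))
                     (BT (Dat 2 i (fun o => o != None))))))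
    else BC (w == blank)
  end.

Definition written_x m (side : bool) : bexp :=
  match m with
  | Stay => BA (BC side) (bzero i)
  | GoRight => BA (BC (~~ side)) (bzero i)
  | GoLeft => BA (BC side) (bone i)
  end.

Definition source_x m (side side' : bool) : bexp :=
  match m with
  | Stay => BA (BC (side' == side)) (beq i' i)
  | GoRight => if side then BA (BC side') (bsucc i' i)
     else BO (BA (bzero i) (BA (BC side') (bzero i')))
             (BA (BN (bzero i)) (BA (BC (~~ side')) (bsucc i i')))
  | GoLeft => if side then
       BO (BA (bzero i) (BA (BC (~~ side')) (bzero i')))
          (BA (BN (bzero i)) (BA (BC side') (bsucc i i')))
     else BA (BC (~~ side')) (bsucc i' i)
  end.

(** The source is then one position further out. At the last position it falls outside the tableau,
    and the clause is waived by means of [dat 4]. *)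
Definition from_right m (side : bool) :=
  match m with Stay => false | GoRight => side | GoLeft => ~~ side end.

Definition here k k' := BA (beq t' t) (BA (beq i' i) (BC (k' == k))).

(* The literal "cell [(t', i', k')] has value [w]" belongs to the clause
   [(t, i, r)].  Rule [None]: the input is contiguous; [Some None]: the run
   accepts; [Some (Some (inl k))]: initial cells; otherwise transitions. *)
Definition literal_x (r : rule) k' w : bexp :=
  match r with
  | None => BO (BN (bzero t)) (BO (bzero i)
      (BA (BA (beq t' t) (BC (k' == input_kind)))
          (BO (BA (beq i' i) (BC (w == blank)))
              (BA (bsucc i i') (BC (w != blank))))))
  | Some None => BO (BN (BT (Dat 3 t (fun o => o == Some true))))
      (BA (beq t' t) (BA (bzero i') (BC ((k' == input_kind) && (w == bit true)))))
  | Some (Some (inl k)) => BO (BN (bzero t)) (BA (here k k') (allowed_x k w))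
  | Some (Some (inr (v, k, a))) =>
      BO (bzero t)
      (BO (BA (bsucc t t') (BA (bzero i') (BC
         match k' with
         | None => w != inl v.1
         | Some (j, side) => side && (w != inr (v.2 j))
         end)))
      match k with
      | None => BA (here k k') (BC (w == inl (outcome v).1))
      | Some (j, side) =>
        let: (b, m) := (outcome v).2 j in
        BO (BA (BC (from_right m side)) (BT (Dat 4 i (fun o => o == Some true))))
        (BO (BA (written_x m side) (BA (here k k') (BC (w == inr b))))
            (BA (BN (written_x m side))
              (BO (BA (here k k') (BC (w == a)))
                  (BA (bsucc t t') (BA (BC (w != a))
                     match k' with
                     | Some (j', side') => BA (BC (j' == j)) (source_x m side side')
                     | None => BC false
                     end)))))
      end)
  end.

End Clauses.

Definition cell := (nat * nat * kind)%type.
Definition clause := (nat * nat * rule)%type.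

Definition literal dat (C : clause) (c : cell) w : bool :=
  beval dat [:: C.1.1; C.1.2; c.1.1; c.1.2] (literal_x 0 1 2 3 C.2 c.2 w).

Lemma beval_literal dat env t i t' i' r k w :
  beval dat env (literal_x t i t' i' r k w) =
  literal dat (nth 0 env t, nth 0 env i, r) (nth 0 env t', nth 0 env i', k) w.
Proof.
rewrite /literal /literal_x; case: r => [[[k0|[[v [[j s]|]] a]]|]|] //=.
- by case: k0 => //= -[j s]; case: ifP.
- case: ((outcome v).2 j) => b m /=; case: k => [[j' s']|]; case: m; case: s => //=.
Qed.

Lemma wf_literal d t i t' i' r k w : t < d -> i < d -> t' < d -> i' < d ->
  uniq [:: t; i; t'; i'] -> bexp_wf d (literal_x t i t' i' r k w).
Proof.
move=> td id_ t'd i'd /=; rewrite !inE !negb_or.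
case/and4P=> /and3P[n1 n2 n3] /andP[n4 n5] n6 _.
have E := (td, id_, t'd, i'd, n1, n2, n3, n4, n5, n6,
  eq_sym t' t, eq_sym i' i).
rewrite /literal_x; case: r => [[[k0|[[v [[j s]|]] a]]|]|] /=; rewrite ?E //=.
- by case: k0 => //= -[j s]; case: ifP => //=; rewrite ?E.
- case: ((outcome v).2 j) => b m /=; case: k => [[j' s']|]; case: m; case: s => //=;
    by rewrite ?E.
Qed.

End Tableau.

Lemma onth_mark n i : (onth (rcons (nseq n false) true) i == Some true) = (i == n).
Proof. by elim: n i => [|n IH] [|i] //=; rewrite ?onth0n. Qed.

Lemma onth_unary n i : (onth (nseq n true) i != None) = (i < n).
Proof. by rewrite onth_nseq; case: ltnP. Qed.

Lemma onth_zero i : (onth [:: true; false] i == Some true) = (i == 0).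
Proof. by case: i => [|[|[|i]]]. Qed.

Lemma onth_one i : (onth [:: true; false] i == Some false) = (i == 1).
Proof. by case: i => [|[|[|i]]]. Qed.

(** * Solutions of the constraint problem and accepting runs *)

Section Correct.
Variables (M : machine) (z : bits) (L T : nat) (dat : nat -> bits).
Hypotheses (dat1 : dat 1 = z) (dat2 : dat 2 = nseq L true).
Hypotheses (dat3 : dat 3 = rcons (nseq T false) true).
Hypotheses (dat4 : dat 4 = rcons (nseq T.+1 false) true).
Hypotheses (dat5 : dat 5 = [:: true; false]).
Notation B := T.+2.
Notation kind := (kind M).
Notation value := (value M).
Notation input_kind := (input_kind M).
Implicit Types (s : cell M -> value) (k : kind) (w a : value).

Definition satisfied s (C : clause M) := exists c : cell M,
  [/\ c.1.1 < B, c.1.2 < B & literal dat C c (s c)].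

Definition satisfying s := forall C : clause M,
  C.1.1 < B -> C.1.2 < B -> satisfied s C.

Lemma beval_source t i t' i' m side side' :
  beval dat [:: t; i; t'; i'] (source_x 1 3 m side side') =
  (source m side i == (side', i')).
Proof.
by case: m; case: side side' => -[]; rewrite /= ?dat5 ?onth_zero ?addn0 ?addn1;
  rewrite ?xpair_eqE; case: i => [|i] //=; rewrite ?xpair_eqE /=; lia.
Qed.

Lemma beval_written t i t' i' m side :
  beval dat [:: t; i; t'; i'] (written_x 1 m side) = written m side i.
Proof.
by case: m => /=; rewrite dat5 ?onth_zero ?onth_one.
Qed.

Definition allowed i k w : bool :=
  match k with
  | None => w == inl (mstart M)
  | Some (j, side) =>
    if (j == ord0) && side then
      if onth z i is Some b then w == bit M b
      else (w == blank M) || ((w == bit M true) || (w == bit M false)) && (i < L)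
    else w == blank M
  end.

Lemma literal_init t i k t' i' k' w :
  literal dat (t, i, Some (Some (inl k))) (t', i', k') w =
  (t != 0) || [&& t' == t, i' == i, k' == k & allowed i k w].
Proof.
rewrite /literal /= !addn0 dat5 onth_zero -!andbA; congr [|| _ | [&& _, _, _ & _]].
case: k => [[j side]|] //=; case: ifP => //= _.
by rewrite dat1 dat2 onth_unary; case: (onth z i) => [b|] //=; rewrite orbF.
Qed.

Lemma literal_contiguous t i t' i' k' w :
  literal dat (t, i, None) (t', i', k') w =
  [|| t != 0, i == 0 | [&& t' == t, k' == input_kind &
    ((i' == i) && (w == blank M)) || ((i == i'.+1) && (w != blank M))]].
Proof.
by rewrite /literal /= !addn0 addn1 dat5 !onth_zero -!andbA.
Qed.

Lemma literal_accept t i t' i' k' w :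
  literal dat (t, i, Some None) (t', i', k') w =
  (t != T) || [&& t' == t, i' == 0, k' == input_kind & w == bit M true].
Proof.
by rewrite /literal /= !addn0 dat3 dat5 onth_mark onth_zero.
Qed.

Lemma literal_state t i v a t' i' k' w :
  literal dat (t, i, Some (Some (inr (v, None, a)))) (t', i', k') w =
  [|| t == 0,
   [&& t == t'.+1, i' == 0 & match k' with
        | None => w != inl v.1
        | Some (j, side) => side && (w != inr (v.2 j)) end] |
   [&& t' == t, i' == i, k' == None & w == inl (outcome v).1]].
Proof.
by rewrite /literal /= !addn0 addn1 dat5 !onth_zero -!andbA.
Qed.

(** Clauses are disjunctions, so a transition reads: the view at the previous time is not [v], or
    the source does not hold [a], or the cell has the resulting value. A negated hypothesis is the
    set of all other values of its cell. *)
Lemma literal_tape t i v j side a t' i' k' w :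
  let b := ((outcome v).2 j).1 in let m := ((outcome v).2 j).2 in
  literal dat (t, i, Some (Some (inr (v, Some (j, side), a)))) (t', i', k') w =
  [|| t == 0,
   [&& t == t'.+1, i' == 0 & match k' with
        | None => w != inl v.1
        | Some (j, side) => side && (w != inr (v.2 j)) end],
   from_right m side && (i == T.+1) |
   if written m side i then
     [&& t' == t, i' == i, k' == Some (j, side) & w == inr b]
   else [&& t' == t, i' == i, k' == Some (j, side) & w == a] ||
     [&& t == t'.+1, w != a & match k' with
        | None => false
        | Some (j', side') => (j' == j) && (source m side i == (side', i')) end]].
Proof.
rewrite /literal /=; case: ((outcome v).2 j) => b m.
rewrite [LHS]/= beval_written !addn0 addn1 dat4 dat5 !onth_zero onth_mark -!andbA.
congr [|| _, _, _ | _]; case: (written m side i) => /=; first by rewrite orbF.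
by case: k' => [[j' side']|] //=; rewrite beval_source.
Qed.

Lemma source_lt m side i :
  (source m side i).2 <= i + from_right m side.
Proof. by case: m; case: side; case: i => //= i; lia. Qed.

Lemma input_cell (y : bits) k i : cellval (init_config M y) k i =
  match k with
  | None => inl (mstart M)
  | Some (j, side) => if (j == ord0) && side then
      if onth y i is Some b then bit M b else blank M else blank M
  end.
Proof.
case: k => [[j side]|] //=; rewrite /tcell; case: (j == ord0) => /=; last first.
  by case: side; rewrite ?nth_nil //; case: i => //= i; rewrite nth_nil.
case: side; last by case: y => [|b y] /=; rewrite nth_nil.
case: y => [|b y] /=; first by case: i => //= i; rewrite nth_nil.
case: i => //= i; elim: y i => [|c y IH] [|i] //=; exact: IH.
Qed.

Lemma runS (x : bits) t : run M x t.+1 = step (run M x t).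
Proof. by []. Qed.

Lemma satisfying_run (y : bits) : size y <= L - size z ->
  thead (ctape (run M (z ++ y) T) ord0) = Some (inl true) ->
  satisfying (fun c => cellval (run M (z ++ y) c.1.1) c.2 c.1.2).
Proof.
move=> sy acc [[t i] r] /= tB iB; case: r => [[[k|[[v k] a]]|]|].
- case: t tB => [|t] tB; last by exists (0, 0, k); split=> //; rewrite literal_init.
  exists (0, i, k); split=> //; rewrite literal_init !eqxx /= input_cell.
  case: k => [[j side]|] /=; last by rewrite ?eqxx.
  case: ((j == ord0) && side); last by rewrite ?eqxx.
  rewrite onth_cat; case: ltnP => zi; rewrite -?onthTE in zi *.
    by case: (onth z i) zi.
  rewrite onth_default //; case E : (onth y _) => [b|]; last by rewrite ?eqxx.
  have : i - size z < size y by rewrite -onthTE E.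
  move=> ?; rewrite (_ : i < L); last lia.
  by case: (b); rewrite ?eqxx ?orbT.
- case: t tB => [|t] tB.
    exists (0, 0, None); split=> //.
    by case: k => [[j side]|]; [rewrite literal_tape|rewrite literal_state].
  (* If [v] is not the actual view, the clause is hit by a cell on which they differ: the state or a
     scanned symbol. *)
  have [Ev|] := eqVneq v (view_of (run M (z ++ y) t)); last first.
    rewrite /view_of; case: v => q f ne.
    have [Eq|nq] := eqVneq q (cstate (run M (z ++ y) t)); last first.
      exists (t, 0, None); split=> //=; first lia.
      by case: k => [[j side]|]; [rewrite literal_tape|rewrite literal_state];
        rewrite /= !eqxx /= (inj_eq (@inl_inj _ _)) eq_sym nq ?orbT.
    have [j nj] : exists j, f j != thead (ctape (run M (z ++ y) t) j).
      apply/existsP; rewrite -negb_forall; apply: contra ne => /forallP H.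
      by rewrite xpair_eqE Eq eqxx; apply/eqP/ffunP => j; rewrite ffunE; apply/eqP.
    exists (t, 0, Some (j, true)); split=> //=; first lia.
    by case: k => [[j' side]|]; [rewrite literal_tape|rewrite literal_state];
      rewrite /= !eqxx /= (inj_eq (@inr_inj _ _)) eq_sym nj ?orbT.
  case: k => [[j side]|]; last first.
    exists (t.+1, i, None); split=> //; rewrite literal_state !eqxx.
    apply/or3P; constructor 3; apply/eqP.
    by rewrite [LHS]cellval_step -Ev.
  have Ecell : cellval (run M (z ++ y) t.+1) (Some (j, side)) i =
      let w := (outcome v).2 j in
      inr (tcell (move_tape w.2 (write_tape w.1 (ctape (run M (z ++ y) t) j))) side i).
    by rewrite runS cellval_step -Ev.
  rewrite /= tcell_move in Ecell.
  case wr : (written ((outcome v).2 j).2 side i).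
    exists (t.+1, i, Some (j, side)); split=> //.
    rewrite literal_tape wr !eqxx; apply/or4P; constructor 4; apply/eqP.
    by rewrite [LHS]Ecell wr.
  have [/andP[fr iT]|nfr] := boolP (from_right ((outcome v).2 j).2 side && (i == T.+1)).
    exists (0, 0, None); split=> //; by rewrite literal_tape fr iT ?orbT.
  (* An unwritten cell has the value of its source: either this is [a] and the cell hits the clause,
     or it is not and the source does. *)
  have [Ea|na] := eqVneq (cellval (run M (z ++ y) t.+1) (Some (j, side)) i) a.
    exists (t.+1, i, Some (j, side)); split=> //.
    rewrite literal_tape wr !eqxx; apply/or4P; constructor 4.
    by apply/orP; left; apply/eqP.
  have lt := source_lt ((outcome v).2 j).2 side i.
  case Es : (source ((outcome v).2 j).2 side i) lt Ecell => [side' i'] lt Ecell.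
  exists (t, i', Some (j, side')); split=> //=; first lia.
    by move: nfr lt => /=; case: from_right => /=; lia.
  rewrite literal_tape wr Es !eqxx; apply/or4P; constructor 4.
  apply/orP; right; rewrite /= andbT; apply: contra na => /eqP <-.
  by rewrite [X in X == _]Ecell wr.
- have [->|nt] := eqVneq t T; last first.
    by exists (0, 0, None); split=> //; rewrite literal_accept nt.
  exists (T, 0, input_kind); split=> //.
  by rewrite literal_accept !eqxx /= /tcell /= acc eqxx ?orbT.
- have [->|nt] := eqVneq t 0; last first.
    by exists (0, 0, None); split=> //; rewrite literal_contiguous nt.
  case: i iB => [|i] iB.
    by exists (0, 0, None); split=> //; rewrite literal_contiguous.
  have [Eb|nb] := eqVneq (onth (z ++ y) i.+1) None.
    exists (0, i.+1, input_kind); split=> //.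
    rewrite literal_contiguous !eqxx; apply/or3P; constructor 3.
    rewrite !andTb; apply/orP; left; apply/eqP.
    by rewrite [LHS](input_cell _ input_kind) Eb.
  exists (0, i, input_kind); split=> //=; first lia.
  rewrite literal_contiguous !eqxx; apply/or3P; constructor 3.
  rewrite !andTb; apply/orP; right; apply/eqP.
  rewrite [X in X = _](input_cell _ input_kind) /input_kind eqxx andbT.
  have : i < size (z ++ y).
    move: nb; have := onthTE (z ++ y) i.+1.
    by case: (onth _ _) => //= b /esym; lia.
  by rewrite -onthTE; case: (onth _ i).
Qed.

(** Since [s] agrees with [C] at the heads, no literal denying the view can hold, and the clause is
    reduced to the rest of its disjunction. *)
Lemma satisfied_transition s C i t k a : satisfying s ->
  (forall k', s (t, 0, k') = cellval C k' 0) ->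
  t.+1 < B -> i < B ->
  satisfied s (t.+1, i, Some (Some (inr (view_of C, k, a)))) ->
  match k with
  | None => s (t.+1, i, k) = inl (outcome (view_of C)).1
  | Some (j, side) => let: (b, m) := (outcome (view_of C)).2 j in is_true
      [|| from_right m side && (i == T.+1) |
      if written m side i then s (t.+1, i, k) == inr b
      else (s (t.+1, i, k) == a) ||
        (s (t, (source m side i).2, Some (j, (source m side i).1)) != a)]
  end.
Proof.
move=> Hs E0 tB iB [[[t' i'] k'] [/= _ _]].
have absurd : ~~ [&& t.+1 == t'.+1, i' == 0 & match k' with
        | None => s (t', i', k') != inl (view_of C).1
        | Some (j, side) => side && (s (t', i', k') != inr ((view_of C).2 j)) end].
  apply/negP => /and3P[/eqP [<-] /eqP -> ].
  by rewrite E0; case: k' => [[j []]|] //=; rewrite ?ffunE eqxx.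
case: k => [[j side]|].
  rewrite literal_tape (negbTE absurd) /=.
  case: ((outcome _).2 j) => b m /=.
  case/orP=> [->//|]; case: (written m side i).
    by case/and4P=> /eqP -> /eqP -> /eqP -> ->; rewrite orbT.
  case/orP=> [/and4P[/eqP -> /eqP -> /eqP -> ->]|]; first by rewrite orbT.
  case/and3P=> /eqP [->]; case: k' {absurd} => [[j' side']|] //.
  by move=> + /andP[/eqP <- /eqP ->] /= => ->; rewrite !orbT.
rewrite literal_state (negbTE absurd) /=.
by case/and4P=> /eqP -> /eqP -> /eqP -> /eqP.
Qed.

(** As the clauses may be waived at the last position, one more position is lost at each step, and
    only the triangle [t + i < B] is determined. It contains [(T, 0)], where acceptance is
    tested. *)
Lemma satisfying_cells s (y : bits) : satisfying s ->
  (forall k i, i < B -> s (0, i, k) = cellval (init_config M y) k i) ->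
  forall t k i, t + i < B -> s (t, i, k) = cellval (run M y t) k i.
Proof.
move=> Hs H0; elim=> [|t IH] k i tiB; first by apply: H0.
have E0 k' : s (t, 0, k') = cellval (run M y t) k' 0 by apply: IH; lia.
have tB : t.+1 < B by lia.
have iB : i < B by lia.
have tr a := satisfied_transition Hs E0 tB iB
  (Hs (t.+1, i, Some (Some (inr (view_of (run M y t), k, a)))) tB iB).
rewrite runS cellval_step; case: k tr => [[j side]|] tr; last first.
  exact: (tr (blank M)).
case E : ((outcome (view_of (run M y t))).2 j) tr => [b m] /= tr.
rewrite tcell_move; have lt := source_lt m side i.
case: (boolP (from_right m side && (i == T.+1))) => [/andP[_ /eqP]|nfr].
  by lia.
case: (boolP (written m side i)) tr => wr tr.
  (* A written cell does not depend on the source, so any value of [a] serves. *)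
  apply/eqP; have := tr (blank M).
  by rewrite (negbTE nfr).
have Es : s (t, (source m side i).2, Some (j, (source m side i).1)) =
    inr (tcell (ctape (run M y t) j) (source m side i).1 (source m side i).2).
  by rewrite IH //=; move: lt; case: from_right; lia.
(* Taking for [a] the actual content of the source rules out the literal that denies it. *)
apply/eqP; have := tr (inr (tcell (ctape (run M y t) j)
   (source m side i).1 (source m side i).2)).
by rewrite (negbTE nfr) Es eqxx orbF.
Qed.

(** The initial clauses constrain the cells one by one and would allow blanks between bits. The
    contiguity clauses propagate a blank to the right, so the guessed bits form a single word after
    [z]. *)
Lemma satisfying_input s : satisfying s -> size z <= L ->
  exists2 y : bits, size y <= L - size z &
  forall k i, i < B -> s (0, i, k) = cellval (init_config M (z ++ y)) k i.
Proof.
move=> Hs zL.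
have Hall i k : i < B -> allowed i k (s (0, i, k)).
  move=> iB; have [|//|[[t' i'] k'] [_ _]] := Hs (0, i, Some (Some (inl k))) => //.
  by rewrite literal_init /= => /and4P[/eqP -> /eqP -> /eqP ->].
pose f i := s (0, i, input_kind).
have Hcontig i : i.+1 < B -> f i = blank M -> f i.+1 = blank M.
  move=> iB; have [|//|[[t' i'] k'] [_ _]] := Hs (0, i.+1, None) => //.
  rewrite literal_contiguous /f /= => /and3P[/eqP -> /eqP ->].
  case/orP=> [/andP[/eqP -> /eqP]//|/andP[/eqP [->] H] E].
  by rewrite E eqxx in H.
(* The length of the certificate: it ends at the first blank after [z], or at the edge of the
   tableau if there is none. *)
pose m := find (fun i => f i == blank M) (iota (size z) (B - size z)).
have mB : m <= B - size z by rewrite -[X in _ <= X](size_iota (size z)) find_size.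
have f_in i : size z <= i < size z + m -> f i != blank M.
  move=> Hi; have : i - size z < m by lia.
  move/(before_find 0); rewrite nth_iota; last lia.
  by rewrite subnKC; [move->|lia].
have f_out i : size z + m <= i < B -> f i = blank M.
  elim: i => [|i IH] Hi; last first.
    have [Hi'|Hi'] := leqP (size z + m) i; first by apply: Hcontig; [lia|apply: IH; lia].
    have <- : size z + m = i.+1 by lia.
    have : has (fun i => f i == blank M) (iota (size z) (B - size z)).
      by rewrite has_find size_iota -/m; lia.
    by move/(nth_find 0); rewrite -/m nth_iota; [move/eqP|lia].
  have : has (fun i => f i == blank M) (iota (size z) (B - size z)).
    by rewrite has_find size_iota -/m; lia.
  move/(nth_find 0); rewrite -/m nth_iota; last lia.
  by rewrite (_ : size z + m = 0); [move/eqP|lia].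
have f_bit i : size z <= i < size z + m ->
    f i = bit M (f i == bit M true) /\ i < L.
  move=> Hi; have := Hall i input_kind; rewrite /allowed /input_kind eqxx andTb.
  rewrite -/(f i) onth_default; last lia.
  rewrite (negbTE (f_in i Hi)) /= => /(_ _) /andP[]; first lia.
  by move=> + ->; case/orP=> /eqP ->; rewrite ?eqxx.
exists [seq f i == bit M true | i <- iota (size z) m].
  rewrite size_map size_iota; case: (m) f_bit => // m' f_bit.
  by have [] := f_bit (size z + m'); lia.
move=> k i iB; rewrite input_cell; have := Hall i k iB; rewrite /allowed.
case: k => [[j side]|]; last by move/eqP.
case E : ((j == ord0) && side); last by move/eqP.
have -> : Some (j, side) = input_kind by move/andP: E => [/eqP -> ->].
rewrite -/(f i) onth_cat; have [zi|zi] := ltnP i (size z).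
  by have := onthTE z i; rewrite zi; case: (onth z i) => // b _ /eqP.
move=> _; have [im|im] := ltnP i (size z + m); last first.
  by rewrite onth_default ?size_map ?size_iota ?f_out //; lia.
have -> : onth [seq f i == bit M true | i <- iota (size z) m] (i - size z) =
    Some (f i == bit M true).
  rewrite onthE (nth_map false) ?size_map ?size_iota; last lia.
  by rewrite (nth_map 0) ?size_iota ?nth_iota ?subnKC //; lia.
by have [] := f_bit i; first lia.
Qed.

Theorem tableau_correct : size z <= L ->
  (exists s, satisfying s) <->
  (exists2 y : bits, size y <= L - size z &
     thead (ctape (run M (z ++ y) T) ord0) = Some (inl true)).
Proof.
move=> zL; split=> [[s Hs]|[y sy acc]]; last first.
  by exists (fun c => cellval (run M (z ++ y) c.1.1) c.2 c.1.2); apply: satisfying_run.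
have [y sy H0] := satisfying_input Hs zL; exists y => //.
have E := satisfying_cells Hs H0.
have [||[[t' i'] k'] [_ _]] := Hs (T, 0, Some None) => //.
rewrite literal_accept eqxx /= => /and4P[/eqP -> /eqP -> /eqP ->].
by rewrite E ?addn0 //= => /eqP [].
Qed.

End Correct.

(** * The instance of the fair k-center problem *)

Import Order.TTheory GRing.Theory Num.Theory.

Lemma map_cst (T U : Type) (x : U) (s : seq T) : [seq x | _ <- s] = nseq (size s) x.
Proof. by elim: s => //= _ s ->. Qed.

Section Grid.
Variable B : nat.

(** The order matters: it is that of the printing program, with two loops around an unrolled finite
    enumeration. *)
Definition grid (F : finType) : seq (nat * nat * F) :=
  [seq (p, f) | p <- [seq (t, i) | t <- iota 0 B, i <- iota 0 B], f <- enum F].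

Lemma mem_grid (F : finType) (c : nat * nat * F) :
  (c \in grid F) = (c.1.1 < B) && (c.1.2 < B).
Proof.
apply/allpairsP/andP => [[[p f] [/allpairsP[[t i] [/= tB iB ->]] _ ->]]|[tB iB]].
  by rewrite !mem_iota in tB iB.
exists c; case: c tB iB => [[t i] f] /= tB iB; split; rewrite ?mem_enum //.
by apply/allpairsP; exists (t, i); rewrite !mem_iota.
Qed.

Lemma uniq_grid (F : finType) : uniq (grid F).
Proof.
apply: allpairs_uniq => [||[p f] [p' f'] _ _ //]; last exact: enum_uniq.
by apply: allpairs_uniq => [||[p f] [p' f'] _ _ //]; apply: iota_uniq.
Qed.

End Grid.

Section Instance.
Variables (kind value rule : finType) (k0 : kind) (w0 : value) (B : nat).
Notation cell := (nat * nat * kind)%type.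
Notation clause := (nat * nat * rule)%type.
Variable lit : clause -> cell -> value -> bool.
Hypothesis B_gt0 : 0 < B.

Definition key := option (option clause * cell)%type.
(* [inl (None, c, w)]: choosing [w] for the cell [c];  [inl (Some C, c, w)]: the
   copy of this choice attached to the clause [C];  [inr (Some (D, C))]: the
   client that asks for [D] to be satisfied by the copies attached to [C];
   [inr None]: the isolated point. *)
Definition point := ((option clause * cell * value) + option (clause * clause))%type.
Implicit Types (c : cell) (C D : clause) (w : value) (g : key) (p q : point).

Definition cells := grid B kind.
Definition clauses := grid B rule.

Definition keys : seq key :=
  [seq Some (None, c) | c <- cells] ++
  [seq Some (Some C, c) | C <- clauses, c <- cells] ++ [:: None].

Definition members g : seq point :=
  match g with
  | Some oc => [seq inl (oc, w) | w <- enum value]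
  | None => [seq inr (Some (D, C)) | D <- clauses, C <- clauses] ++ [:: inr None]
  end.

Definition key_of p : key := if p is inl x then Some x.1 else None.

(** Listed group by group, so that the group of a point can be printed by counting the groups
    already passed. *)
Definition points : seq point := flatten [seq members g | g <- keys].

Lemma key_of_members g p : p \in members g -> key_of p = g.
Proof.
case: g => [oc /mapP[w _ ->] //|]; rewrite mem_cat.
by case/orP=> [/allpairsP[x [_ _ ->]]|/[!inE] /eqP ->].
Qed.

Lemma uniq_members g : uniq (members g).
Proof.
case: g => [oc|] /=; first by rewrite map_inj_uniq ?enum_uniq // => w w' [].
rewrite cat_uniq allpairs_uniq ?uniq_grid //=; last by move=> [x y] [x' y'] _ _ [-> ->].
by rewrite orbF andbT; apply/allpairsP => -[x [_ _]].
Qed.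

Lemma uniq_keys : uniq keys.
Proof.
rewrite /keys !cat_uniq map_inj_uniq ?uniq_grid /=; last by move=> x y [].
rewrite allpairs_uniq ?uniq_grid //=; last by move=> [x y] [x' y'] _ _ [-> ->].
rewrite orbF andbT; apply/andP; split; last by apply/allpairsP => -[x [_ _]].
apply/hasPn => g; rewrite mem_cat inE => /orP[/allpairsP[x [_ _ ->]]|/eqP ->];
  by apply/mapP => -[].
Qed.

Lemma mem_keys g : (g \in keys) =
  match g with
  | None => true
  | Some (None, c) => c \in cells
  | Some (Some C, c) => (C \in clauses) && (c \in cells)
  end.
Proof.
rewrite /keys !mem_cat inE; case: g => [[[C|] c]|]; last by rewrite !orbT.
- rewrite !orbF; apply/orP/andP => [[/mapP[] //|/allpairsP[[x y] [/= Cx cx [-> ->]]]] //|[HC Hc]].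
  by right; apply/allpairsP; exists (C, c).
- rewrite orbF; apply/orP/idP => [[/mapP[x Hx [->]] //|/allpairsP[] x [] //]|Hc].
  by left; apply: map_f.
Qed.

Lemma mem_members p : (p \in members (key_of p)) =
  if p is inr (Some (D, C)) then (D \in clauses) && (C \in clauses) else true.
Proof.
case: p => [[oc w]|[[D C]|]] /=; first by rewrite map_f ?mem_enum.
  rewrite mem_cat inE orbF; apply/allpairsP/andP => [[[x y] [/= Dx Cy [-> ->]]] //|[HD HC]].
  by exists (D, C).
by rewrite mem_cat inE eqxx orbT.
Qed.

Lemma mem_points p : (p \in points) = (key_of p \in keys) && (p \in members (key_of p)).
Proof.
apply/flatten_mapP/andP => [[g gk pg]|[gk pg]]; last by exists (key_of p).
by rewrite (key_of_members pg).
Qed.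

Lemma uniq_points : uniq points.
Proof.
rewrite /points; elim: keys uniq_keys => //= g gs IH /andP[ngs ugs].
rewrite cat_uniq uniq_members IH // andbT; apply/hasPn => p.
case/flatten_mapP=> g' g'gs pg'; apply/negP => pg.
by move: ngs; rewrite -(key_of_members pg) (key_of_members pg') g'gs.
Qed.

Lemma cell0_in : (0, 0, k0) \in cells.
Proof. by rewrite mem_grid /= B_gt0. Qed.

Lemma z_in : (inr None : point) \in points.
Proof. by rewrite mem_points mem_keys mem_members. Qed.

Definition gap p q : nat :=
  if p == q then 0 else
  match p, q with
  | inl (None, c, _), inl (None, c', _) => if c == c' then 1 else 2
  | inl (None, c, w), inl (Some C, _, _)
  | inl (Some C, _, _), inl (None, c, w) => if lit C c w then 1 else 2
  | inl (Some _, _, _), inl (Some _, _, _) => 2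
  | inl (None, c, w), inr (Some (_, C))
  | inr (Some (_, C)), inl (None, c, w) => if lit C c w then 2 else 3
  | inl (Some C', c, w), inr (Some (D, C))
  | inr (Some (D, C)), inl (Some C', c, w) =>
      if (C' == C) && lit D c w then 1 else 3
  | inr (Some _), inr (Some _) => 2
  | inr None, _ | _, inr None => 3
  end.

Lemma gap_sym p q : gap p q = gap q p.
Proof.
rewrite /gap eq_sym; case: (q == p) => //.
case: p q => [[[[C|] c] w]|[[D C]|]] [[[[C'|] c'] w']|[[D' C']|]] //.
by rewrite eq_sym.
Qed.

Lemma gap_eq0 p q : (gap p q == 0) = (p == q).
Proof.
rewrite /gap; case: (p =P q) => // ne.
case: p q ne => [[[[C|] c] w]|[[D C]|]] [[[[C'|] c'] w']|[[D' C']|]] //= ne;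
  by repeat case: ifP => ?.
Qed.

Lemma gap_le3 p q : gap p q <= 3.
Proof.
rewrite /gap; case: (p =P q) => // _.
case: p q => [[[[C|] c] w]|[[D C]|]] [[[[C'|] c'] w']|[[D' C']|]] //=;
  by repeat case: ifP => ?.
Qed.

(** The only way the triangle inequality could fail, as nonzero distances lie between 1 and 3. The
    critical path goes from some [Y] through a copy attached to [C] to a client [(D, C)]: its first
    step says that the [Y] hits [C], which puts the ends at distance 2. *)
Lemma gap_close p q r : gap p q = 1 -> gap q r = 1 -> gap p r <= 2.
Proof.
rewrite /gap; case: (p =P q) => // _; case: (q =P r) => // _; case: (p =P r) => // _.
case: q => [[[[C|] c] w]|[[D C]|]];
case: p => [[[[C1|] c1] w1]|[[D1 C1]|]];
case: r => [[[[C2|] c2] w2]|[[D2 C2]|]] //=; do ?case: ifP => //.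
- by move=> H /andP[/eqP E _]; rewrite E H.
- by move=> H + /andP[/eqP E _]; rewrite E H.
Qed.

Lemma gap_triangle p q r : gap p r <= gap p q + gap q r.
Proof.
have [->|pq] := eqVneq p q; first by rewrite leq_addl.
have [->|qr] := eqVneq q r; first by rewrite leq_addr.
move: pq qr; rewrite -!gap_eq0 => pq qr.
have := @gap_close p q r; have := gap_le3 p r; lia.
Qed.

Definition pt (u : 'I_(size points)) : point := tnth (in_tuple points) u.

Lemma pt_inj : injective pt.
Proof. exact/tuple_uniqP/uniq_points. Qed.

Lemma mem_pt u : pt u \in points. Proof. exact: mem_tnth. Qed.

Lemma pt_onto p : p \in points -> exists u, pt u = p.
Proof. by move/(@tnthP _ _ (in_tuple points)) => [u ->]; exists u. Qed.

Lemma map_pt : [seq pt u | u <- enum 'I_(size points)] = points.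
Proof. exact: (@map_tnth_enum _ _ (in_tuple points)). Qed.

Lemma index_key_lt u : index (key_of (pt u)) keys < size keys.
Proof. by rewrite index_mem; have := mem_pt u; rewrite mem_points => /andP[]. Qed.

Local Open Scope ring_scope.

Definition ptdist u v : rat := (gap (pt u) (pt v))%:R.
Definition ptgroup u : 'I_(size keys) := Ordinal (index_key_lt u).

Lemma npts_gt0 : (0 < size points)%N.
Proof. by have := z_in; case: points. Qed.

Lemma ptdist_ge0 u v : 0 <= ptdist u v.
Proof. exact: ler0n. Qed.

Lemma ptdist_eq0 u v : ptdist u v = 0 <-> u = v.
Proof.
split=> [/eqP|->]; last by apply/eqP; rewrite pnatr_eq0 gap_eq0.
by rewrite pnatr_eq0 gap_eq0 => /eqP/pt_inj.
Qed.

Lemma ptdist_sym u v : ptdist u v = ptdist v u.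
Proof. by rewrite /ptdist gap_sym. Qed.

Lemma ptdist_triangle u v x : ptdist u x <= ptdist u v + ptdist v x.
Proof. by rewrite -natrD ler_nat gap_triangle. Qed.

Lemma members_neq0 g : exists p, p \in members g.
Proof.
case: g => [oc|]; last by exists (inr None); rewrite (mem_members (inr None)).
by exists (inl (oc, w0)); rewrite (mem_members (inl (oc, w0))).
Qed.

Lemma ptgroup_surj i : exists u, ptgroup u = i.
Proof.
have [p pg] := members_neq0 (nth None keys i).
have kp := key_of_members pg.
have /pt_onto[u up] : p \in points by rewrite mem_points kp pg mem_nth.
by exists u; apply: val_inj; rewrite /= up kp index_uniq ?uniq_keys.
Qed.

Definition csp_instance : fair_instance :=
  @FairInstance (size points) (size keys) ptdist ptgroup (fun=> 1%N)
    npts_gt0 ptdist_ge0 ptdist_eq0 ptdist_sym ptdist_triangle ptgroup_surj.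
Notation I := csp_instance.

Lemma csp_one_per_group : one_per_group I.
Proof. by split=> //; rewrite /ncenters /= sum1_card card_ord. Qed.

Lemma enum_pt (T : Type) (f : point -> T) :
  [seq f (pt u) | u <- enum 'I_(size points)] = [seq f p | p <- points].
Proof. by rewrite -[in RHS]map_pt -map_comp. Qed.

Lemma encode_csp : encode_instance I =
  encode_nat (size points) ++ encode_nat (size keys) ++
  flatten [seq encode_nat (index (key_of p) keys) | p <- points] ++
  flatten [seq encode_nat 1 | _ <- keys] ++
  flatten [seq encode_rat (gap p q)%:R | p <- points, q <- points].
Proof.
rewrite /encode_instance; congr (_ ++ _ ++ flatten _ ++ flatten _ ++ flatten _).
- by rewrite -(enum_pt (fun p => encode_nat (index (key_of p) keys))).
- by rewrite (map_cst (encode_nat 1)) [LHS](map_cst (encode_nat 1)) size_enum_ord.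
- by rewrite -[in RHS]map_pt allpairs_mapl allpairs_mapr.
Qed.

(** Stated on bit strings because this is what the machine evaluates: the rows of the printed matrix
    against the answer. *)
Definition covers (s : bits) : bool :=
  all (fun row => has (fun x => x.1 && x.2) (zip row s))
    [seq [seq (gap p q < 3)%N | q <- points] | p <- points].

Lemma has_zip_map (T : Type) (a b : T -> bool) (s : seq T) :
  has (fun x => x.1 && x.2) (zip [seq a x | x <- s] [seq b x | x <- s]) =
  has (fun x => a x && b x) s.
Proof. by elim: s => //= x s ->. Qed.

Lemma coversP (S : {set 'I_(npoints I)}) : reflect
  (forall u : 'I_(size points), exists2 v, v \in S & (gap (pt u) (pt v) < 3)%N)
  (covers (encode_solution S)).
Proof.
have E u : has (fun x : bool * bool => x.1 && x.2)
    (zip [seq (gap (pt u) q < 3)%N | q <- points] (encode_solution S)) =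
    [exists v in S, (gap (pt u) (pt v) < 3)%N].
  rewrite -(enum_pt (fun q => gap (pt u) q < 3)%N) has_zip_map.
  apply/hasP/existsP => [[v _ /andP[vg vS]]|[v /andP[vS vg]]].
    by exists v; rewrite vS.
  by exists v; rewrite ?mem_enum // vg.
rewrite /covers all_map; apply: (iffP allP) => [H u|H p].
  by have := H _ (mem_pt u); rewrite /= E => /exists_inP.
by case/pt_onto=> u <-; rewrite /= E; apply/exists_inP; exact: H.
Qed.

Lemma card_groups (S : {set 'I_(npoints I)}) :
  #|S| = (\sum_(i < ngroups I) #|S :&: group i|)%N.
Proof.
rewrite -sum1_card (partition_big (@group_of I) xpredT) //=.
apply: eq_bigr => i _; rewrite sum1_card; apply: eq_card => u.
by rewrite !inE.
Qed.

Lemma feasible_csp (S : {set 'I_(npoints I)}) :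
  feasible S = [forall i : 'I_(size keys), #|S :&: group (I:=I) i| == 1%N].
Proof.
rewrite /feasible; apply/andP/idP => [[_ //]|H]; split=> //.
rewrite card_groups /ncenters; apply/eqP/eq_bigr => i _.
by apply/eqP; exact: (forallP H).
Qed.

Definition satisfiable := exists s : cell -> value, forall C, C \in clauses ->
  exists2 c, c \in cells & lit C c (s c).

Lemma feasible_center (S : {set 'I_(npoints I)}) g : feasible S -> g \in keys ->
  exists2 u, u \in S & key_of (pt u) = g.
Proof.
rewrite feasible_csp => /forallP H gk; have gi : (index g keys < size keys)%N by rewrite index_mem.
have := H (Ordinal gi) => /cards1P[u Eu].
have : u \in S :&: group (I:=I) (Ordinal gi) by rewrite Eu set11.
rewrite !inE => /andP[uS /eqP[E]]; exists u => //.
rewrite -(nth_index None gk) -E nth_index //.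
by have := mem_pt u; rewrite mem_points => /andP[].
Qed.

Lemma feasible_unique (S : {set 'I_(npoints I)}) u v : feasible S ->
  u \in S -> v \in S -> key_of (pt u) = key_of (pt v) -> u = v.
Proof.
rewrite feasible_csp => /forallP H uS vS E.
have /cards1P[x Ex] := H (ptgroup u).
have : u \in S :&: group (I:=I) (ptgroup u) by rewrite !inE uS eqxx.
have : v \in S :&: group (I:=I) (ptgroup u).
  by rewrite !inE vS /=; apply/eqP/val_inj; rewrite /= E.
by rewrite Ex !inE => /eqP -> /eqP.
Qed.

(* Either the choices of the groups [(None, c)] satisfy every clause, or they
   violate some [C0], and then the clients [(D, C0)] can only be served by the
   copies attached to [C0], whose choices satisfy every [D]. *)
Lemma covers_satisfiable (S : {set 'I_(npoints I)}) :
  feasible S -> covers (encode_solution S) -> satisfiable.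
Proof.
move=> fS /coversP cov.
have sel o c : exists w, (Some (o, c) \in keys) ==>
    [exists u in S, pt u == inl (o, c, w)].
  have [ok|_] := boolP (_ \in keys); last by exists w0.
  have [u uS ku] := feasible_center fS ok.
  case E : (pt u) ku => [[oc w]|x] //= [Eoc]; exists w.
  by apply/existsP; exists u; rewrite uS E Eoc eqxx.
have unsel D C : (inr (Some (D, C)) : point) \notin [seq pt u | u in S].
  apply/imageP => -[u uS Eu].
  have [z zS Ez] : exists2 z, z \in S & pt z = inr None.
    have [z0 Ez0] := pt_onto z_in; have [z zS] := cov z0; rewrite Ez0 => Hz.
    by exists z => //; move: Hz; rewrite /gap; case: (pt z) => [[[[]]]|[]].
  have : u = z by apply: feasible_unique fS uS zS _; rewrite -Eu Ez.
  by move=> uz; move: Eu; rewrite uz Ez.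
pose s o c : value := xchoose (sel o c).
have sP o c : Some (o, c) \in keys -> exists2 u, u \in S & pt u = inl (o, c, s o c).
  move=> ok; have /implyP/(_ ok)/exists_inP[u uS /eqP Eu] := xchooseP (sel o c).
  by exists u.
have sE o c w u : u \in S -> pt u = inl (o, c, w) -> w = s o c.
  move=> uS Eu; have ok : Some (o, c) \in keys.
    by have := mem_pt u; rewrite mem_points Eu => /andP[].
  have [v vS Ev] := sP o c ok.
  have uv : u = v by apply: feasible_unique fS uS vS _; rewrite Eu Ev.
  by move: Eu; rewrite uv Ev => -[].
have [/allP H|/allPn[C0 C0in nC0]] :=
    boolP (all (fun C => has (fun c => lit C c (s None c)) cells) clauses).
  by exists (s None) => C /H /hasP.
exists (s (Some C0)) => D Din.
have /pt_onto[u Eu] : inr (Some (D, C0)) \in points.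
  by rewrite mem_points mem_keys mem_members Din.
have [v vS] := cov u; rewrite Eu; case Ev : (pt v) => [[[[C|] c] w]|[[D' C']|]] //.
- rewrite /gap /=; case: eqP => [EC|] //; case: ifP => // lD _; subst C.
  have := mem_pt v; rewrite mem_points mem_keys Ev /= => /andP[/andP[_ cin] _].
  by exists c => //; rewrite -(sE _ _ _ _ vS Ev).
- rewrite /gap /=; case: ifP => // lC _; case/negP: nC0; apply/hasP.
  have := mem_pt v; rewrite mem_points mem_keys Ev => /andP[cin _].
  by exists c => //; rewrite -(sE _ _ _ _ vS Ev).
- by move=> _; case/imageP: (unsel D' C'); exists v.
Qed.

(** The choice [s] is made in the [Y] groups and repeated in every copy. A copy attached to [C] is
    served by the [Y] that hits [C], and a client [(D, C)] by the selected copy attached to [C] that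
    hits [D]. *)
Lemma satisfiable_opt : satisfiable -> opt I <= 1.
Proof.
case=> s Hs.
pose sel p := match p with inl (_, c, w) => s c == w | inr x => x == None end.
pose S : {set 'I_(npoints I)} := [set u | sel (pt u)].
have Sin p : p \in points -> sel p -> exists2 u, u \in S & pt u = p.
  by move=> /pt_onto[u <-] su; exists u; rewrite ?inE.
have fS : feasible S.
  rewrite feasible_csp; apply/forallP => i; apply/cards1P.
  pose p : point := if nth None keys i is Some oc then inl (oc, s oc.2) else inr None.
  have kp : key_of p = nth None keys i by rewrite /p; case: (nth None keys i).
  have pin : p \in points.
    rewrite mem_points mem_members kp mem_nth //=.
    by rewrite /p; case: (nth None keys i).
  have selp : sel p by rewrite /p; case: (nth None keys i) => [[o c]|] /=.
  have [u uS Eu] := Sin p pin selp; exists u; apply/setP => v.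
  rewrite !inE; apply/andP/eqP => [[sv /eqP Ev]|->]; last first.
    split; first by rewrite Eu.
    by apply/eqP/val_inj; rewrite /= Eu kp index_uniq ?uniq_keys.
  apply: pt_inj; rewrite Eu /p.
  have : key_of (pt v) = nth None keys i.
    rewrite -Ev /= nth_index //.
    by have := mem_pt v; rewrite mem_points => /andP[].
  by case: (pt v) sv => [[[o c] w]|x] /= /eqP <- <-.
apply: le_trans (bigmin_le_cond _ _ fS) _.
apply: bigmax_le => // u _.
suff [v vS Ev] : exists2 v, v \in S & (gap (pt u) (pt v) <= 1)%N.
  by apply: bigmin_inf vS _; rewrite /= /ptdist -[1]/(1%:R) ler_nat.
have := mem_pt u; rewrite mem_points mem_keys mem_members.
case Eu : (pt u) => [[[[C|] c] w]|[[D C]|]] //=.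
- case/andP=> /andP[Cin cin] _; have [c0 c0in l0] := Hs C Cin.
  have [||v vS Ev] := Sin (inl (None, c0, s c0)) => //=.
    by rewrite mem_points mem_keys mem_members /= c0in.
  by exists v => //; rewrite Ev /gap /= l0.
- case/andP=> cin _.
  have [||v vS Ev] := Sin (inl (None, c, s c)) => //=.
    by rewrite mem_points mem_keys mem_members /= cin.
  by exists v => //; rewrite Ev /gap /= eqxx; case: ifP.
- case/andP=> Din Cin; have [c0 c0in l0] := Hs D Din.
  have [||v vS Ev] := Sin (inl (Some C, c0, s c0)) => //=.
    by rewrite mem_points mem_keys mem_members /= c0in Cin.
  by exists v => //; rewrite Ev /gap /= eqxx l0.
- by move=> _; exists u; rewrite ?inE Eu // /gap eqxx.
Qed.

(** In [cost] the minimum over the centers is capped by [diameter]; a cost below 3 yields a close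
    center only because the cap is at least 3. *)
Lemma diameter_ge3 : 3 <= diameter I.
Proof.
have [z Ez] := pt_onto z_in.
have [|u Eu] := @pt_onto (inl (None, (0%N, 0%N, k0), w0)).
  by rewrite mem_points mem_keys mem_members /= andbT cell0_in.
rewrite /diameter; apply: (bigmax_sup z) => //; apply: (bigmax_sup u) => //.
by rewrite /= /ptdist Ez Eu.
Qed.

Lemma cost_covers (S : {set 'I_(npoints I)}) :
  cost S < 3 -> covers (encode_solution S).
Proof.
move=> cS; apply/coversP => u; apply/exists_inP; apply: contraTT cS => /exists_inPn H.
rewrite -leNgt /cost; apply: (bigmax_sup u) => //.
apply/bigmin_geP; split=> [|v vS]; first exact: diameter_ge3.
by rewrite /= /ptdist ler_nat leqNgt H.
Qed.

End Instance.

(** * Printing the instance *)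

Lemma foldl_one (T R : Type) (F : R -> T -> R) z x : foldl F z [:: x] = F z x.
Proof. by []. Qed.

Lemma foldl_map (S T R : Type) (F : R -> T -> R) (h : S -> T) z s :
  foldl F z (map h s) = foldl (fun z x => F z (h x)) z s.
Proof. by elim: s z => //= x s IH z. Qed.

Lemma foldl_allpairs (S T U R : Type) (F : R -> U -> R) (f : S -> T -> U) z s t :
  foldl F z [seq f x y | x <- s, y <- t] =
  foldl (fun z x => foldl (fun z y => F z (f x y)) z t) z s.
Proof. by elim: s z => //= x s IH z; rewrite foldl_cat foldl_map IH. Qed.

Lemma flatten_allpairs (S T U : Type) (f : S -> T -> seq U) s t :
  flatten [seq f x y | x <- s, y <- t] =
  flatten [seq flatten [seq f x y | y <- t] | x <- s].
Proof. by elim: s => //= x s IH; rewrite flatten_cat IH. Qed.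

Lemma eq_foldl (T R : Type) (F G : R -> T -> R) :
  (forall z x, F z x = G z x) -> forall s z, foldl F z s = foldl G z s.
Proof. by move=> E; elim=> //= x s IH z; rewrite E IH. Qed.

Section Printer.
Variables (M : machine) (dat : nat -> bits) (B : nat).
Notation kind := (kind M).
Notation value := (value M).
Notation rule := (rule M).
Notation point := (point kind value rule).
Notation ev := (ev dat B).
Notation mems := (members (kind := kind) value (rule := rule) B).
Notation ks := (keys kind rule B).
Notation pts := (points kind value rule B).
Notation gap := (gap (literal dat)).
Implicit Types (env : seq nat) (st : nat * bits) (k : kind) (w : value) (r : rule).

Definition each (T : Type) (s : seq T) (f : T -> prog) : prog :=
  foldr (fun x p => Then (f x) p) (Emit [::]) s.

Lemma ev_each (T : Type) (s : seq T) f env st :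
  ev (each s f) env st = foldl (fun st x => ev (f x) env st) st s.
Proof. by elim: s st => [|x s IH] st //=; rewrite cats0 -surjective_pairing. Qed.

Lemma wf_each (T : Type) (s : seq T) f d :
  d <= 8 -> (forall x, wf d (f x)) -> wf d (each s f).
Proof. by move=> d8 H; elim: s => //= x s ->; rewrite H. Qed.

Definition for_grid (F : finType) (f : F -> prog) : prog :=
  For (For (each (enum F) f)).

Lemma ev_for_grid (F : finType) f env st G :
  (forall t i x st, ev (f x) (rcons (rcons env t) i) st = G st (t, i, x)) ->
  ev (for_grid (F := F) f) env st = foldl G st (grid B F).
Proof.
move=> H; rewrite /grid !foldl_allpairs /=.
apply: eq_foldl => st1 t; apply: eq_foldl => st2 i.
by rewrite ev_each; apply: eq_foldl => st3 x; rewrite H.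
Qed.

Lemma wf_for_grid (F : finType) f d :
  d.+1 < 8 -> (forall x, wf d.+2 (f x)) -> wf d (for_grid (F := F) f).
Proof. by move=> d8 H /=; rewrite d8 (ltnW d8) wf_each. Qed.

(* Points without the indices, which are held by the loop variables. *)
Inductive shape :=
  | ShapeY of kind & value
  | ShapeA of rule & kind & value
  | ShapeC of rule & rule
  | ShapeZ.

Definition arity (a : shape) : nat :=
  match a with ShapeY _ _ => 2 | ShapeZ => 0 | _ => 4 end.

Definition at_vars env o (a : shape) : point :=
  let e i := nth 0 env (i + o) in
  match a with
  | ShapeY k w => inl (None, (e 0, e 1, k), w)
  | ShapeA r k w => inl (Some (e 0, e 1, r), (e 2, e 3, k), w)
  | ShapeC r r' => inr (Some ((e 0, e 1, r), (e 2, e 3, r')))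
  | ShapeZ => inr None
  end.

(** [sep] runs once after each group, so the same traversal can count points, count groups or keep
    track of the current group. *)
Definition for_points (f : shape -> prog) (sep : prog) : prog :=
  Then (for_grid (fun k : kind => Then (each (enum value) (fun w => f (ShapeY k w))) sep))
 (Then (for_grid (fun r : rule => for_grid (fun k : kind =>
          Then (each (enum value) (fun w => f (ShapeA r k w))) sep)))
 (Then (for_grid (fun r : rule => for_grid (fun r' : rule => f (ShapeC r r'))))
 (Then (f ShapeZ) sep))).

Lemma nth_cat_rcons env i s : nth 0 (env ++ s) (i + size env) = nth 0 s i.
Proof. by rewrite nth_cat ltnNge leq_addl /= addnK. Qed.

Lemma ev_then p q env st : ev (Then p q) env st = ev q env (ev p env st).
Proof. by []. Qed.

Lemma foldl_members (T : Type) (G : T -> point -> T) oc z :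
  foldl G z (mems (Some oc)) =
  foldl (fun z w => G z (inl (oc, w))) z (enum value).
Proof. exact: foldl_map. Qed.

Lemma foldl_members_none (T : Type) (G : T -> point -> T) z :
  foldl G z (mems None) =
  G (foldl (fun z D => foldl (fun z C => G z (inr (Some (D, C)))) z
       (clauses rule B)) z (clauses rule B)) (inr None).
Proof. by rewrite /members foldl_cat foldl_allpairs. Qed.

(** [e] stands for the loop variables that the traversal binds on top of [env]; a nonempty [env]
    allows one traversal inside another, as the distance matrix requires. *)
Lemma ev_for_points f sep env st G H :
  (forall a e st, size e = arity a ->
     ev (f a) (env ++ e) st = G st (at_vars (env ++ e) (size env) a)) ->
  (forall e st, ev sep e st = H st) ->
  ev (for_points f sep) env st =
  foldl (fun st g => H (foldl G st (mems g))) st ks.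
Proof.
move=> HG HH; rewrite /keys !foldl_cat foldl_map foldl_allpairs.
have EY t i k st1 : ev (Then (each (enum value) (fun w => f (ShapeY k w))) sep)
    (rcons (rcons env t) i) st1 =
    H (foldl G st1 (mems (Some (None, (t, i, k))))).
  rewrite ev_then HH ev_each foldl_members; congr H; apply: eq_foldl => st2 w.
  by rewrite -!cats1 -catA HG // /at_vars !nth_cat_rcons.
have EA t i r t' i' k st1 : ev (Then (each (enum value) (fun w => f (ShapeA r k w))) sep)
    (rcons (rcons (rcons (rcons env t) i) t') i') st1 =
    H (foldl G st1 (mems (Some (Some (t, i, r), (t', i', k))))).
  rewrite ev_then HH ev_each foldl_members; congr H; apply: eq_foldl => st2 w.
  by rewrite -!cats1 -!catA HG // /at_vars !nth_cat_rcons.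
have EC t i r t' i' r' st1 : ev (f (ShapeC r r'))
    (rcons (rcons (rcons (rcons env t) i) t') i') st1 =
    G st1 (inr (Some ((t, i, r), (t', i', r')))).
  by rewrite -!cats1 -!catA HG // /at_vars !nth_cat_rcons.
have EZ st1 : ev (f ShapeZ) env st1 = G st1 (inr None).
  by have := HG ShapeZ [::] st1 erefl; rewrite cats0.
rewrite /for_points !ev_then HH EZ foldl_one foldl_members_none.
congr (H (G _ _)).
rewrite (@ev_for_grid _ _ _ _ (fun z D => foldl (fun z C =>
  G z (inr (Some (D, C)))) z (clauses rule B))) => [|t i r st4]; last first.
  by apply: (@ev_for_grid _ _ _ _ (fun z C => G z (inr (Some (t, i, r, C))))) => *;
    exact: EC.
congr (foldl _ _ _); rewrite (@ev_for_grid _ _ _ _ (fun st C => foldl (fun st c =>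
    H (foldl G st (mems (Some (Some C, c))))) st (cells kind B)))
  => [|t i r st4]; last first.
  apply: (@ev_for_grid _ _ _ _ (fun st c =>
    H (foldl G st (mems (Some (Some (t, i, r), c)))))) => *; exact: EA.
congr (foldl _ _ _); apply: (@ev_for_grid _ _ _ _ (fun st c =>
  H (foldl G st (mems (Some (None, c)))))) => *; exact: EY.
Qed.

Lemma wf_then d p q : wf d (Then p q) = wf d p && wf d q.
Proof. by []. Qed.

Lemma wf_for_points f sep d : d <= 4 ->
  (forall a, wf (d + arity a) (f a)) ->
  (forall d', d' <= 8 -> wf d' sep) -> wf d (for_points f sep).
Proof.
move=> d4 Hf Hs.
have d8 : d <= 8 by lia.
have HY k w : wf d.+2 (f (ShapeY k w)) by have := Hf (ShapeY k w); rewrite addn2.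
have HA r k w : wf d.+4 (f (ShapeA r k w)) by have := Hf (ShapeA r k w); rewrite addn4.
have HC r r' : wf d.+4 (f (ShapeC r r')) by have := Hf (ShapeC r r'); rewrite addn4.
have HZ : wf d (f ShapeZ) by have := Hf ShapeZ; rewrite addn0.
rewrite /for_points !wf_then HZ Hs // !andbT; apply/and3P; split.
- apply: wf_for_grid; first lia.
  move=> k; rewrite wf_then Hs ?andbT; last lia.
  by apply: wf_each => [|w]; [lia|exact: HY].
- apply: wf_for_grid => [|r]; first lia.
  apply: wf_for_grid => [|k]; first lia.
  rewrite wf_then Hs ?andbT; last lia.
  by apply: wf_each => [|w]; [lia|exact: HA].
- apply: wf_for_grid => [|r]; first lia.
  by apply: wf_for_grid => [|r']; [lia|exact: HC].
Qed.

Definition same_pos i j := BA (beq i j) (beq i.+1 j.+1).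

Fixpoint gap_prog (out : nat -> prog) a o a' o' {struct a} : prog :=
  match a, a' with
  | ShapeY k w, ShapeY k' w' =>
      cond (BA (BC (k == k')) (same_pos o o'))
        (if w == w' then out 0 else out 1) (out 2)
  | ShapeA r k w, ShapeA r' k' w' =>
      cond (BA (BC [&& r == r', k == k' & w == w'])
              (BA (same_pos o o') (same_pos o.+2 o'.+2))) (out 0) (out 2)
  | ShapeC r1 r2, ShapeC r1' r2' =>
      cond (BA (BC ((r1 == r1') && (r2 == r2')))
              (BA (same_pos o o') (same_pos o.+2 o'.+2))) (out 0) (out 2)
  | ShapeZ, ShapeZ => out 0
  | ShapeZ, _ | _, ShapeZ => out 3
  | ShapeY k w, ShapeA r _ _ =>
      cond (literal_x o' o'.+1 o o.+1 r k w) (out 1) (out 2)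
  | ShapeA r _ _, ShapeY k w =>
      cond (literal_x o o.+1 o' o'.+1 r k w) (out 1) (out 2)
  | ShapeY k w, ShapeC _ r =>
      cond (literal_x o'.+2 o'.+3 o o.+1 r k w) (out 2) (out 3)
  | ShapeC _ r, ShapeY k w =>
      cond (literal_x o.+2 o.+3 o' o'.+1 r k w) (out 2) (out 3)
  | ShapeA r k w, ShapeC r1 r2 =>
      cond (BA (BC (r == r2)) (BA (same_pos o o'.+2)
        (literal_x o' o'.+1 o.+2 o.+3 r1 k w))) (out 1) (out 3)
  | ShapeC r1 r2, ShapeA r k w =>
      cond (BA (BC (r == r2)) (BA (same_pos o' o.+2)
        (literal_x o o.+1 o'.+2 o'.+3 r1 k w))) (out 1) (out 3)
  end.

Lemma ev_gap_prog out a o a' o' env st :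
  ev (gap_prog out a o a' o') env st =
  ev (out (gap (at_vars env o a) (at_vars env o' a'))) env st.
Proof.
have BAE x y : beval dat env (BA x y) = beval dat env x && beval dat env y by [].
have BCE c : beval dat env (BC c) = c by [].
have S i j : beval dat env (beq i j) = (nth 0 env i == nth 0 env j).
  by rewrite /= addn0.
case: a => [k w|r k w|r1 r2|]; case: a' => [k' w'|r' k' w'|r1' r2'|];
  rewrite [gap_prog _ _ _ _ _]/= ?ev_cond; try (rewrite /at_vars /gap;
    case: (_ =P _) => // _; by rewrite beval_literal; case: literal).
all: rewrite /at_vars /gap !BAE BCE !S ?beval_literal !add0n !add1n ?add2n ?add3n.
- rewrite (inj_eq (@inl_inj _ _)) !xpair_eqE eqxx -!andbA.
  by do !case: (_ == _).
- rewrite (inj_eq (@inl_inj _ _)) !xpair_eqE (inj_eq (@Some_inj _)) !xpair_eqE.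
  by do !case: (_ == _).
- case: (inl _ =P _) => // _; rewrite !xpair_eqE.
  by do !case: (_ == _); case: literal.
- case: (inr _ =P _) => // _; rewrite !xpair_eqE.
  by do !case: (_ == _); case: literal.
- rewrite (inj_eq (@inr_inj _ _)) (inj_eq (@Some_inj _)) !xpair_eqE.
  by do !case: (_ == _).
Qed.

Lemma wf_gap_prog out a o a' o' d : o + arity a <= o' -> o' + arity a' <= d ->
  (forall n, wf d (out n)) -> wf d (gap_prog out a o a' o').
Proof.
move=> oo' o'd Hout.
have Hbeq i j : i < d -> j < d -> i != j -> bexp_wf d (beq i j).
  by move=> id_ jd ij; rewrite /= id_ jd.
case: a oo' => [k w|r k w|r1 r2|] /= oo'; case: a' o'd => [k' w'|r' k' w'|r1' r2'|] /= o'd //=.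
all: apply: wf_cond => //=; rewrite ?wf_literal /= ?inE ?andbT; try lia.
by case: (w == w').
Qed.

Definition nop := Emit [::].

Definition distances (f : nat -> bits) : prog :=
  for_points (fun a => for_points (fun a' =>
    gap_prog (fun n => Emit (f n)) a 0 a' (arity a)) nop) nop.

Lemma ev_nop env st : ev nop env st = st.
Proof. by rewrite /= cats0 -surjective_pairing. Qed.

Lemma foldl_points (T : Type) (F : T -> point -> T) z :
  foldl (fun z g => foldl F z (mems g)) z ks = foldl F z pts.
Proof.
by rewrite /points; elim: (ks) z => //= g s IH z; rewrite foldl_cat IH.
Qed.

Lemma foldl_emit (T : Type) (f : T -> bits) s st :
  foldl (fun (st : nat * bits) x => (st.1, st.2 ++ f x)) st s =
  (st.1, st.2 ++ flatten [seq f x | x <- s]).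
Proof.
elim: s st => [|x s IH] [c l] /=; first by rewrite cats0.
by rewrite IH /= catA.
Qed.

Lemma ev_distances f st : ev (distances f) [::] st =
  (st.1, st.2 ++ flatten [seq f (gap p q) | p <- pts, q <- pts]).
Proof.
rewrite /distances (@ev_for_points _ _ _ _
  (fun st p => (st.1, st.2 ++ flatten [seq f (gap p q) | q <- pts])) id);
  last by move=> e st'; rewrite ev_nop.
  by rewrite foldl_points foldl_emit flatten_allpairs.
move=> a e st1 He; rewrite (@ev_for_points _ _ _ _
  (fun st q => (st.1, st.2 ++ f (gap (at_vars e 0 a) q))) id);
  last by move=> e' st'; rewrite ev_nop.
  by rewrite foldl_points foldl_emit.
move=> a' e' st2 He'; rewrite ev_gap_prog /= -He; congr (_, _ ++ f (gap _ _)).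
by rewrite /at_vars; case: (a) He => //= [? ?|? ? ?|? ?] He; rewrite !nth_cat He.
Qed.

Lemma wf_distances f : wf 0 (distances f).
Proof.
rewrite /distances; apply: wf_for_points => // a; rewrite add0n.
have a4 : arity a <= 4 by case: a.
apply: wf_for_points => // a'.
have a'4 : arity a' <= 4 by case: a'.
by apply: wf_gap_prog => // n /=; lia.
Qed.

Lemma foldl_tick (T : Type) (s : seq T) st :
  foldl (fun (st : nat * bits) _ => (st.1.+1, st.2)) st s = (st.1 + size s, st.2).
Proof.
elim: s st => [|x s IH] [c l] /=; first by rewrite addn0.
by rewrite IH /= addSnnS.
Qed.

Lemma foldl_id (T R : Type) (s : seq T) (z : R) : foldl (fun z _ => z) z s = z.
Proof. by elim: s. Qed.

Definition count_points := for_points (fun=> Tick) nop.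
Definition count_keys := for_points (fun=> nop) Tick.
Definition groups := for_points (fun=> EmitC) Tick.
Definition reqs := for_points (fun=> nop) (Emit (encode_nat 1)).

Lemma ev_count_points st : ev count_points [::] st = (st.1 + size pts, st.2).
Proof.
rewrite (@ev_for_points _ _ _ _ (fun st _ => (st.1.+1, st.2)) id) //;
  last by move=> e st'; rewrite ev_nop.
by rewrite foldl_points foldl_tick.
Qed.

Lemma ev_count_keys st : ev count_keys [::] st = (st.1 + size ks, st.2).
Proof.
rewrite (@ev_for_points _ _ _ _ (fun st _ => st) (fun st => (st.1.+1, st.2))) //;
  last by move=> a e st' _; rewrite ev_nop.
rewrite -[RHS]foldl_tick; apply: eq_foldl => z g; by rewrite foldl_id.
Qed.

Lemma ev_reqs st : ev reqs [::] st =
  (st.1, st.2 ++ flatten [seq encode_nat 1 | _ <- ks]).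
Proof.
rewrite (@ev_for_points _ _ _ _ (fun st _ => st)
  (fun st => (st.1, st.2 ++ encode_nat 1))) //;
  last by move=> a e st' _; rewrite ev_nop.
rewrite -(foldl_emit (fun=> encode_nat 1)).
by apply: eq_foldl => z g; rewrite foldl_id.
Qed.

(** The counter is the number of groups completed, which is the index of the current key because the
    keys are distinct. *)
Lemma ev_groups l : ev groups [::] (0, l) = (size ks,
  l ++ flatten [seq encode_nat (index (key_of p) ks) | p <- pts]).
Proof.
rewrite (@ev_for_points _ _ _ _ (fun st _ => (st.1, st.2 ++ encode_nat st.1))
  (fun st => (st.1.+1, st.2))) //.
rewrite /points; set F := (X in foldl X).
have U := uniq_keys kind rule B.
suff H gs pre l' : ks = pre ++ gs -> foldl F (size pre, l') gs =
    (size ks, l' ++ flatten [seq encode_nat (index (key_of p) ks)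
       | p <- flatten [seq mems g | g <- gs]]) by exact: (H _ [::]).
elim: gs pre l' => [|g gs IH] pre l' E.
  by rewrite /= cats0 E cats0.
have Ef c s l1 : foldl (fun (st : nat * bits) (_ : point) =>
    (st.1, st.2 ++ encode_nat st.1)) (c, l1) s =
    (c, l1 ++ flatten [seq encode_nat c | _ <- s]).
  by elim: s l1 => [|x s IHs] l1 /=; rewrite ?cats0 // IHs catA.
rewrite [LHS]/= {2}/F Ef -(size_rcons pre g) IH ?cat_rcons // [flatten (map _ (_ :: _))]/=.
rewrite map_cat flatten_cat catA; congr (_, (_ ++ flatten _) ++ _).
apply/eq_in_map => p /key_of_members ->.
rewrite E index_cat /= eqxx addn0 ifN //.
by move: U; rewrite E cat_uniq => /and3P[_ /norP[]].
Qed.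

Definition print_instance :=
  Then count_points (Then EmitC (Then Reset (Then count_keys (Then EmitC (Then Reset
    (Then groups (Then reqs (distances (fun n => encode_rat n%:R%R))))))))).

Lemma ev_print_instance : (ev print_instance [::] (0, [::])).2 =
  encode_nat (size pts) ++ encode_nat (size ks) ++
  flatten [seq encode_nat (index (key_of p) ks) | p <- pts] ++
  flatten [seq encode_nat 1 | _ <- ks] ++
  flatten [seq encode_rat (gap p q)%:R%R | p <- pts, q <- pts].
Proof.
have emit st : ev EmitC [::] st = (st.1, st.2 ++ encode_nat st.1) by [].
have reset st : ev Reset [::] st = (0, st.2) by [].
rewrite /print_instance ev_then ev_count_points ev_then emit ev_then reset.
rewrite ev_then ev_count_keys ev_then emit ev_then reset ev_then ev_groups.
by rewrite ev_then ev_reqs ev_distances !add0n cat0s -!catA.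
Qed.

Definition print_close := distances (fun n => [:: n < 3]).

Lemma ev_print_close st : ev print_close [::] st =
  (st.1, st.2 ++ flatten [seq [seq gap p q < 3 | q <- pts] | p <- pts]).
Proof.
rewrite /print_close ev_distances flatten_allpairs; congr (_, _ ++ flatten _).
by apply: eq_map => p; elim: (pts) => //= q s ->.
Qed.

Lemma wf_print_instance : wf 0 print_instance.
Proof.
have a4 a : arity a <= 8 by case: a.
have H1 : wf 0 count_points by apply: wf_for_points.
have H2 : wf 0 count_keys by apply: wf_for_points.
have H3 : wf 0 groups by apply: wf_for_points.
have H4 : wf 0 reqs by apply: wf_for_points.
have H5 := wf_distances (fun n => encode_rat n%:R%R).
by repeat (apply/andP; split=> //).
Qed.

End Printer.

(** * The decision machine *)

Section PolyBound.

Definition polyb (f : nat -> nat) := exists q : {poly nat}, forall n, f n <= q.[n]%R.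

Lemma polyb_le f g : (forall n, f n <= g n) -> polyb g -> polyb f.
Proof. by move=> fg [q Hq]; exists q => n; apply: leq_trans (Hq n). Qed.

Lemma polyb_cst c : polyb (fun=> c).
Proof. by exists (c%:P)%R => n; rewrite hornerC. Qed.

Lemma polyb_id : polyb id.
Proof. by exists 'X%R => n; rewrite hornerX. Qed.

Lemma polyb_add f g : polyb f -> polyb g -> polyb (fun n => f n + g n).
Proof. by case=> q Hq [r Hr]; exists (q + r)%R => n; rewrite hornerD leq_add. Qed.

Lemma polyb_mul f g : polyb f -> polyb g -> polyb (fun n => f n * g n).
Proof. by case=> q Hq [r Hr]; exists (q * r)%R => n; rewrite hornerM leq_mul. Qed.

Lemma horner_mono (q : {poly nat}) m n : m <= n -> q.[m]%R <= q.[n]%R.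
Proof.
move=> mn; elim/poly_ind: q => [|q c IH]; first by rewrite !horner0.
by rewrite !hornerMXaddC leq_add2r leq_mul.
Qed.

Lemma polyb_horner (q : {poly nat}) f : polyb f -> polyb (fun n => q.[f n]%R).
Proof.
move=> Hf; elim/poly_ind: q => [|q c IH].
  by apply: polyb_le (polyb_cst 0) => n; rewrite horner0.
apply: (@polyb_le _ (fun n => q.[f n]%R * f n + c)) => [n|].
  by rewrite hornerMXaddC.
by apply: polyb_add (polyb_cst c); apply: polyb_mul.
Qed.

Lemma polyb_double f : polyb f -> polyb (fun n => (f n).*2).
Proof.
move=> Hf; apply: (@polyb_le _ (fun n => f n + f n)) => [n|]; first by rewrite addnn.
exact: polyb_add.
Qed.

Lemma polyb_succ f : polyb f -> polyb (fun n => (f n).+1).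
Proof.
move=> Hf; apply: (@polyb_le _ (fun n => f n + 1)) => [n|]; first by rewrite addn1.
by apply: polyb_add (polyb_cst 1).
Qed.

Lemma polyb_ticks p b : polyb b -> polyb (fun n => ticks (b n) p).
Proof.
move=> Hb; elim: p => /= *; do ?[exact: polyb_cst | exact: polyb_add | exact: polyb_mul].
Qed.

Lemma polyb_steps p u : polyb u -> polyb (fun n => steps p (u n)).
Proof.
move=> Hu; elim: p => /= *; repeat first [exact: polyb_cst | assumption
  | apply: polyb_add | apply: polyb_mul | apply: polyb_succ].
Qed.

End PolyBound.

Ltac polyb_tac := repeat first [exact: polyb_cst | exact: polyb_id | assumption
  | apply: polyb_add | apply: polyb_mul | apply: polyb_succ | apply: polyb_double
  | apply: polyb_steps | apply: polyb_ticks | apply: polyb_horner].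

(** * Running a given machine on the tapes from 36 on *)

Section Embed.
Variable M : machine.
Notation A := (maux M).
Notation K := (36 + mtapes M).
Notation store := (store A).
Notation tm := (tm A K).
Notation stk := (stk A).

Lemma host_lt (j : 'I_(mtapes M).+1) : 36 + j < K.+1.
Proof. by rewrite ltnS leq_add2l -ltnS ltn_ord. Qed.

Definition host (j : 'I_(mtapes M).+1) : 'I_K.+1 := Ordinal (host_lt j).

Definition guest (i : nat) : 'I_(mtapes M).+1 := inord (i - 36).

Lemma guest_host j : guest (host j) = j.
Proof. by rewrite /guest /= addKn inord_val. Qed.

Definition guest_tm : tm :=
  @TM A K (mstate M) (mstart M) (@mhalt M) (fun q r =>
    let: (q', w) := mtrans q [ffun j => r (host j)] in
    (q', [ffun i : 'I_K.+1 => if 36 <= i then w (guest i) else (r i, Stay)])).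

(** Of the final tapes of the guest only the output is described; the data kept on the first 36
    tapes are untouched. *)
Lemma runs_guest (s : store) x t y : halts_with M x t y ->
  s 36 = stk x -> (forall i, 36 < i -> s i = stk [::]) ->
  exists T, output_tape T = y /\
    exists s', runs guest_tm s t s' /\ s' 36 = T /\ forall i, i < 36 -> s' i = s i.
Proof.
case=> Hh Hy E36 Egt.
pose s' i := if i < 36 then s i else ctape (run M x t) (guest i).
exists (ctape (run M x t) ord0); split=> //; exists s'; split; last first.
  split=> [|i i36]; last by rewrite /s' i36.
  by rewrite /s' /=; congr (ctape _ _); apply: val_inj; rewrite /= inordK.
move=> T HT; exists t => //=.
suff [-> HC] : let C := iter t (@step (machine_of guest_tm))
     (@Config (machine_of guest_tm) (mstart M) T) in
   cstate C = cstate (run M x t) /\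
   forall i : 'I_K.+1, teq (ctape C i)
     (if i < 36 then s i else ctape (run M x t) (guest i)) by [].
elim: t {Hh Hy s'} => [|t /= [IH1 IH2]].
  split=> // i; apply: teq_trans (HT i) _; case: ltnP => i36 //=.
  have [Ei|ne] := eqVneq (i : nat) 36.
    rewrite Ei E36 (_ : guest 36 = ord0) ?eqxx //.
    by apply: val_inj; rewrite /= inordK.
  rewrite Egt; last by rewrite ltn_neqAle eq_sym ne.
  rewrite ifN // -val_eqE /= inordK; first by rewrite subn_eq0 -ltnNge ltn_neqAle eq_sym ne.
  by have := ltn_ord i; lia.
set C := iter t _ _ in IH1 IH2 *; rewrite -/(run M x t).
rewrite /step /= IH1.
case: ifP => hh; first by split=> // i; exact: IH2.
have -> : [ffun j => [ffun i => thead (ctape C i)] (host j)] =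
    [ffun j => thead (ctape (run M x t) j)].
  apply/ffunP=> j; rewrite !ffunE; have := IH2 (host j).
  by rewrite guest_host /= => -[].
case: (mtrans _ _) => q w /=; split=> // i; rewrite !ffunE.
have := IH2 i; case: ltnP => i36 H; last by apply/teq_move/teq_write.
by apply: teq_trans H; case: (ctape C i).
Qed.

End Embed.

(* Outside of the loop programs, the tape 0 holds the input, 25 the matrix of the
   pairs of close points, 26 and 27 the selection, 28 whether the current row is
   covered, 29 whether some row is not, and 30 to 33 are used to evaluate
   polynomials in unary.  The tape 36 is the first one of the guest machine. *)
Section Pieces.
Variables (A : finType) (K : nat).
Hypothesis K_big : 36 <= K.
Notation store := (store A).
Notation tm := (tm A K).
Notation stk := (stk A).
Notation push := (push A K).
Notation pop := (pop A K).
Notation mv := (mv A K).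
Implicit Types (s : store) (l m x : bits).

Let le36 i : i <= 36 -> i <= K.
Proof. by move=> H; apply: leq_trans K_big. Qed.

(** A unary product with the length of the input. [unscan] acts as an adder: it moves the input away
    and pushes one mark per bit, after which the input is moved back. *)
Definition mul_loop : tm :=
  while (nonempty 30) (seqm (pop 30) (seqm (unscan A K 32 31 0) (move_all A K 32 0))).

Lemma runs_mul_loop s x a b : s 0 = stk x -> s 32 = stk [::] ->
  s 30 = stk (nseq a true) -> s 31 = stk (nseq b true) ->
  runs mul_loop s (a * (24 * size x + 8) + 1)
    (upd (upd s 30 (stk [::])) 31 (stk (nseq (a * size x + b) true))).
Proof.
elim: a b s => [|a IH] b s E0 E32 E30 E31.
  apply: (@runs_ext _ _ _ s 1 s) => //; last by fin_upd.
  by apply: runs_while0; rewrite (nonempty_reads _ E30) // le36.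
apply: runs_ext.
- apply: runs_whileS.
  + by rewrite (nonempty_reads _ E30) // le36.
  + apply: runs_seq; first exact: runs_pop E30.
    apply: runs_seq.
      by apply: (@runs_unscan _ _ _ _ _ _ [::] b x); lk.
    by apply: (@runs_move_all _ _ _ _ _ (rev x) [::]); rewrite ?le36 //; lk; rewrite ?cats0.
  + by apply: (IH (size x + b)); lk; rewrite ?revK ?cats0.
- by rewrite size_rev; lia.
- fin_upd; first by congr (stk (nseq _ _)); lia.
  by rewrite revK cats0.
Qed.

Definition times_tm : tm := seqm mul_loop (move_all A K 31 30).

Lemma runs_times s x a : s 0 = stk x -> s 32 = stk [::] ->
  s 30 = stk (nseq a true) -> s 31 = stk [::] ->
  runs times_tm s (40 * (a * size x) + 10 * a + 10)
    (upd s 30 (stk (nseq (a * size x) true))).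
Proof.
move=> E0 E32 E30 E31; apply: runs_ext.
- apply: runs_seq; first exact: (runs_mul_loop (b := 0) E0 E32 E30 E31).
  by apply: (@runs_move_all _ _ _ _ _ (nseq (a * size x + 0) true) [::]); rewrite ?le36 //; lk.
- by rewrite size_nseq; lia.
- by fin_upd; rewrite rev_nseq cats0 addn0.
Qed.

(** Horner's scheme, with the coefficients listed by increasing degree. *)
Fixpoint eval_tm (cs : seq nat) : tm :=
  if cs is c :: cs' then
    seqm (eval_tm cs') (seqm times_tm (pushes A K 30 (nseq c true)))
  else skip A K.

Fixpoint eval_steps (cs : seq nat) n : nat :=
  if cs is c :: cs' then
    eval_steps cs' n + 40 * (horner_rec cs' n * n) + 10 * horner_rec cs' n + 4 * c + 15
  else 1.

Lemma runs_eval cs s x : s 0 = stk x -> s 32 = stk [::] ->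
  s 30 = stk [::] -> s 31 = stk [::] ->
  runs (eval_tm cs) s (eval_steps cs (size x))
    (upd s 30 (stk (nseq (horner_rec cs (size x)) true))).
Proof.
move=> E0 E32 E30 E31; elim: cs => [|c cs IH].
  by apply: (@runs_ext _ _ _ s 1 s) => //; [exact: runs_skip|fin_upd].
apply: runs_ext.
- apply: runs_seq; first exact: IH.
  apply: runs_seq; first by apply: (@runs_times _ x (horner_rec cs (size x))); lk.
  by apply: (@runs_pushes _ _ _ _ _ (nseq (horner_rec cs (size x) * size x) true)); lk.
- by rewrite /= size_nseq; lia.
- by fin_upd; rewrite rev_nseq -nseqD addnC.
Qed.

Lemma polyb_eval cs : polyb (eval_steps cs).
Proof.
elim: cs => [|c cs IH] /=; first exact: polyb_cst.
have H : polyb (horner_rec cs).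
  elim: cs {IH} => [|c' cs IH] /=; first exact: polyb_cst.
  by apply: polyb_add (polyb_cst _); apply: polyb_mul polyb_id.
by polyb_tac.
Qed.

(** The input is read from its end, so that its delimited code can be pushed on 1 back to front; 2
    receives two marks per bit, to measure this code. *)
Definition code_loop : tm :=
  while (nonempty 32) (seqm (push 2 true) (seqm (push 2 true) (seqm
    (ite (fun f => top f 32 == Some true) (push 1 true) (push 1 false))
    (seqm (push 1 true) (mv 32 0))))).

Lemma runs_code_loop s x y l n : s 32 = stk y -> s 0 = stk x ->
  s 1 = stk l -> s 2 = stk (nseq n true) ->
  runs code_loop s (30 * size y + 1)
    (upd (upd (upd (upd s 0 (stk (rev y ++ x))) 32 (stk [::]))
      1 (stk (flatten [seq [:: true; b] | b <- rev y] ++ l)))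
      2 (stk (nseq ((size y).*2 + n) true))).
Proof.
elim: y x l n s => [|b y IH] x l n s E32 E0 E1 E2.
  apply: (@runs_ext _ _ _ s 1 s) => //; last by fin_upd.
  by apply: runs_while0; rewrite (nonempty_reads _ E32) // le36.
apply: runs_ext.
- apply: runs_whileS.
  + by rewrite (nonempty_reads _ E32) // le36.
  + apply: runs_seq; first exact: runs_push E2.
    apply: runs_seq; first by apply: (@runs_push _ _ _ _ _ (true :: nseq n true)); lk.
    set s2 := upd (upd _ _ _) _ _.
    apply: runs_seq.
      apply: (@runs_ite _ _ _ _ _ s2 3 (upd s2 1 (stk (b :: l)))).
      rewrite (@top_reads _ _ _ _ (b :: y)) ?le36 //.
      by case: b {E32 IH}; apply: runs_push; rewrite /s2; lk.
    apply: runs_seq; first by apply: (@runs_push _ _ _ _ _ (b :: l)); rewrite /s2; lk.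
    by apply: (@runs_mv _ _ _ _ _ b y x); rewrite ?le36 //; rewrite /s2; lk.
  + by apply: (IH (b :: x) (true :: b :: l) n.+2); lk.
- by rewrite /=; lia.
- fin_upd.
  + by rewrite !addnS.
  + by rewrite rev_cons map_rcons flatten_rcons -catA.
  + by rewrite rev_cons cat_rcons.
Qed.

Definition push_list (rs : seq nat) b : tm :=
  foldr (fun r M => seqm (push r b) M) (skip A K) rs.

Lemma runs_push_list rs b s l : uniq rs -> (forall r, r \in rs -> s r = stk l) ->
  runs (push_list rs b) s (4 * size rs + 1)
    (fun i => if i \in rs then stk (b :: l) else s i).
Proof.
elim: rs s => [|r rs IH] s /= => [_ _|/andP[nr U] E]; first exact: runs_skip.
apply: runs_ext.
- apply: runs_seq; first by apply: runs_push; apply: E; rewrite inE eqxx.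
  apply: IH => // q qs; rewrite updN ?E ?inE ?qs ?orbT //.
  by apply: contraNneq nr => <-.
- by move: (size rs) => n; lia.
- move=> i _; rewrite /upd inE; case: (eqVneq i r) => [->|//].
  by rewrite (negbTE nr).
Qed.

Definition wregs : seq nat := [seq 10 + i.*2 | i <- iota 0 8].

Definition bound_loop : tm :=
  while (nonempty 30) (seqm (pop 30) (seqm (push 3 false) (seqm (push 4 false)
    (push_list wregs true)))).

Lemma runs_bound_loop s n f l b : s 30 = stk (nseq n true) ->
  s 3 = stk f -> s 4 = stk l ->
  (forall r, r \in wregs -> s r = stk (nseq b true)) ->
  runs bound_loop s (50 * n + 1)
    (fun i => if i \in wregs then stk (nseq (n + b) true) else
     upd (upd (upd s 30 (stk [::])) 3 (stk (nseq n false ++ f)))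
       4 (stk (nseq n false ++ l)) i).
Proof.
elim: n f l b s => [|n IH] f l b s E30 E3 E4 Ew.
  apply: (@runs_ext _ _ _ s 1 s) => //.
    by apply: runs_while0; rewrite (nonempty_reads _ E30) // le36.
  by move=> i iK; case: ifP => [/Ew -> //|_]; move: i iK; fin_upd.
apply: runs_ext.
- apply: runs_whileS.
  + by rewrite (nonempty_reads _ E30) // le36.
  + apply: runs_seq; first exact: runs_pop E30.
    apply: runs_seq; first by apply: (@runs_push _ _ _ _ _ f); lk.
    apply: runs_seq; first by apply: (@runs_push _ _ _ _ _ l); lk.
    apply: (@runs_push_list wregs true _ (nseq b true)) => // r rw.
    by rewrite -(Ew r rw) !updN //; apply: contraTneq rw => ->.
  + apply: (IH (false :: f) (false :: l) b.+1) => //.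
    by move=> r rw; rewrite rw.
- rewrite size_map size_iota; lia.
- move=> i iK; rewrite addSnnS; case: ifP => [//|iw].
  by rewrite /upd iw !nseq_catS; repeat (case: eqP => // _).
Qed.

(* The bits stored at 3 and 4 mark the times [T] and [T + 1], the last index of
   the tableau. *)
Definition csp_data x L T k : bits :=
  match k with
  | 1 => delimit x
  | 2 => nseq L true
  | 3 => rcons (nseq T false) true
  | 4 => rcons (nseq T.+1 false) true
  | 5 => [:: true; false]
  | _ => [::]
  end.

Definition input_store x : store := fun i => if i == 0 then stk x else stk [::].

Definition ready_store x L T : store := fun i =>
  if i == 0 then stk x
  else if i \in wregs then stk (nseq T.+2 true) else stk (csp_data x L T i).

(** [cP] and [cT] are the coefficients of the bounds on the certificate and on the time of the
    verifier. The two final rounds on [wregs] raise [T] to the side [T.+2] of the tableau. *)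
Definition ready_tm (cP cT : seq nat) : tm :=
  seqm (eval_tm cP) (seqm (move_all A K 30 33) (seqm (eval_tm cT)
  (seqm (push 1 false) (seqm (push 2 true) (seqm (move_all A K 0 32)
  (seqm code_loop (seqm (move_all A K 33 2)
  (seqm (push 3 true) (seqm (push 4 true) (seqm (push 4 false)
  (seqm bound_loop (seqm (push_list wregs true) (seqm (push_list wregs true)
  (seqm (push 5 false) (push 5 true))))))))))))))).

Definition ready_steps cP cT n :=
  eval_steps cP n + eval_steps cT n + 10 * horner_rec cP n + 10 * horner_rec cP n +
  40 * n + 50 * horner_rec cT n + 200.

Lemma runs_ready cP cT x :
  let n := size x in
  let T := horner_rec cT n in let L := horner_rec cP n + n.*2.+1 in
  runs (ready_tm cP cT) (input_store x) (ready_steps cP cT n) (ready_store x L T).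
Proof.
move=> n T L; pose s0 := input_store x; pose P := horner_rec cP n.
pose st (l : seq (nat * bits)) : store :=
  foldr (fun p s => upd s p.1 (stk p.2)) s0 l.
have E1 : runs (eval_tm cP) s0 (eval_steps cP n) (st [:: (30, nseq P true)]).
  exact: runs_eval.
have E2 : runs (move_all A K 30 33) (st [:: (30, nseq P true)]) (10 * P + 1)
    (st [:: (33, nseq P true)]).
  apply: runs_ext; first apply: (@runs_move_all _ _ 30 33 _ (nseq P true) [::]);
    rewrite ?le36 //.
  - by rewrite size_nseq.
  - by rewrite /st /=; fin_upd; rewrite ?cats0 ?rev_nseq.
have E3 : runs (eval_tm cT) (st [:: (33, nseq P true)]) (eval_steps cT n)
    (st [:: (30, nseq T true); (33, nseq P true)]).
  exact: runs_eval.
have E4 : runs (push 1 false) (st [:: (30, nseq T true); (33, nseq P true)]) 3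
    (st [:: (1, [:: false]); (30, nseq T true); (33, nseq P true)]).
  exact: (@runs_push _ _ _ _ _ [::]).
have E5 : runs (push 2 true) (st [:: (1, [:: false]); (30, nseq T true); (33, nseq P true)]) 3
    (st [:: (2, [:: true]); (1, [:: false]); (30, nseq T true); (33, nseq P true)]).
  exact: (@runs_push _ _ _ _ _ [::]).
have E6 : runs (move_all A K 0 32)
    (st [:: (2, [:: true]); (1, [:: false]); (30, nseq T true); (33, nseq P true)])
    (10 * n + 1)
    (st [:: (0, [::]); (32, rev x ++ [::]); (2, [:: true]); (1, [:: false]);
            (30, nseq T true); (33, nseq P true)]).
  by apply: (@runs_move_all _ _ 0 32 _ x [::]).
have E7 : runs code_loop
    (st [:: (0, [::]); (32, rev x ++ [::]); (2, [:: true]); (1, [:: false]);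
            (30, nseq T true); (33, nseq P true)])
    (30 * n + 1)
    (st [:: (2, nseq n.*2.+1 true); (1, delimit x); (30, nseq T true); (33, nseq P true)]).
  apply: runs_ext; first apply: (@runs_code_loop _ [::] (rev x) [:: false] 1);
    rewrite /st /= ?cats0 //.
  - by rewrite size_rev.
  - fin_upd.
    + by rewrite size_rev addn1.
    + by rewrite revK cats1.
    + by rewrite revK ?cats0.
have E8 : runs (move_all A K 33 2)
    (st [:: (2, nseq n.*2.+1 true); (1, delimit x); (30, nseq T true); (33, nseq P true)])
    (10 * P + 1)
    (st [:: (2, nseq L true); (1, delimit x);
            (30, nseq T true)]).
  apply: runs_ext; first apply: (@runs_move_all _ _ 33 2 _ (nseq P true) (nseq n.*2.+1 true));
    rewrite ?le36 //.
  - by rewrite size_nseq.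
  - by rewrite /st /=; fin_upd; rewrite rev_nseq -[_ :: _]/(nseq n.*2.+1 true) -nseqD.
have E9 : runs (push 3 true) (st [:: (2, nseq L true); (1, delimit x); (30, nseq T true)]) 3
    (st [:: (3, [:: true]); (2, nseq L true); (1, delimit x); (30, nseq T true)]).
  exact: (@runs_push _ _ _ _ _ [::]).
have E10 : runs (push 4 true)
    (st [:: (3, [:: true]); (2, nseq L true); (1, delimit x); (30, nseq T true)]) 3
    (st [:: (4, [:: true]); (3, [:: true]); (2, nseq L true); (1, delimit x); (30, nseq T true)]).
  exact: (@runs_push _ _ _ _ _ [::]).
have E11 : runs (push 4 false)
    (st [:: (4, [:: true]); (3, [:: true]); (2, nseq L true); (1, delimit x); (30, nseq T true)]) 3
    (st [:: (4, [:: false; true]); (3, [:: true]); (2, nseq L true); (1, delimit x);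
            (30, nseq T true)]).
  apply: runs_ext; first exact: (@runs_push _ _ _ _ _ [:: true]); first by [].
  by rewrite /st /=; fin_upd.
have wr i : i \in wregs -> (9 < i) && (i < 25) by rewrite !inE; lia.
pose s1 := st [:: (4, nseq T false ++ [:: false; true]); (3, nseq T false ++ [:: true]);
   (2, nseq L true); (1, delimit x)].
pose sw b (s : store) : store := fun i => if i \in wregs then stk (nseq b true) else s i.
have E12 : runs bound_loop
    (st [:: (4, [:: false; true]); (3, [:: true]); (2, nseq L true); (1, delimit x);
            (30, nseq T true)])
    (50 * T + 1) (sw T s1).
  apply: runs_ext; first apply: (@runs_bound_loop _ T [:: true] [:: false; true] 0) => //.
  - move=> r /wr rw; rewrite /st /= !updN ?/s0; try lia.
    by rewrite /input_store ifN //; lia.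
  - by [].
  - move=> i _; rewrite /sw addn0; case: ifP => // _.
    by rewrite /s1 /st /= /upd; repeat (case: eqP => [?|_]; subst => //=).
have Es1 i : i \in wregs -> s1 i = stk [::].
  move/wr=> rw; rewrite /s1 /st /= !updN; try lia.
  by rewrite /s0 /input_store ifN //; lia.
have Epush b : runs (push_list wregs true) (sw b s1) 33 (sw b.+1 s1).
  apply: runs_ext; first apply: (@runs_push_list wregs true _ (nseq b true)) => //.
  - by move=> r rw; rewrite /sw rw.
  - by [].
  - by move=> i _; rewrite /sw; case: (i \in wregs).
have E13 := Epush T; have E14 := Epush T.+1.
have E15 : runs (push 5 false) (sw T.+2 s1) 3 (upd (sw T.+2 s1) 5 (stk [:: false])).
  exact: (@runs_push _ _ _ _ _ [::]).
have E16 : runs (push 5 true) (upd (sw T.+2 s1) 5 (stk [:: false])) 3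
    (upd (upd (sw T.+2 s1) 5 (stk [:: false])) 5 (stk [:: true; false])).
  exact: (@runs_push _ _ _ _ _ [:: false]).
apply: runs_ext.
- apply: (runs_seq E1); apply: (runs_seq E2); apply: (runs_seq E3).
  apply: (runs_seq E4); apply: (runs_seq E5); apply: (runs_seq E6).
  apply: (runs_seq E7); apply: (runs_seq E8); apply: (runs_seq E9).
  apply: (runs_seq E10); apply: (runs_seq E11); apply: (runs_seq E12).
  apply: (runs_seq E13); apply: (runs_seq E14); exact: (runs_seq E15 E16).
- by rewrite /ready_steps -/P -/T -/n; lia.
- move=> i _; rewrite /ready_store.
  case: (boolP (i \in wregs)) => iw; last first.
    rewrite /upd /sw (negbTE iw) /s1 /st /= /upd /s0 /input_store.
    case: eqP => [->//|n5]; case: eqP => [->|n4]; first by rewrite /= nseq_catS -cats1.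
    case: eqP => [->|n3]; first by rewrite /= -cats1.
    case: eqP => [->//|n2]; case: eqP => [->//|n1]; case: eqP => // n0.
    by case: i n0 n1 n2 n3 n4 n5 {iw} => [|[|[|[|[|[|i]]]]]].
  have := wr i iw => ri; rewrite !updN; [|lia|lia].
  by rewrite /sw iw ifN //; lia.
Qed.

Lemma polyb_ready cP cT : polyb (ready_steps cP cT).
Proof.
have H cs : polyb (horner_rec cs).
  elim: cs => [|c' cs IH] /=; first exact: polyb_cst.
  by apply: polyb_add (polyb_cst _); apply: polyb_mul polyb_id.
have [HP HT] := (H cP, H cT); have [EP ET] := (polyb_eval cP, polyb_eval cT).
by rewrite /ready_steps; polyb_tac.
Qed.

(** The test on 28 keeps the flag to a single mark. The selection ends up reversed on 27, from where
    [check_loop] takes it back for the next row. *)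
Definition row_loop : tm :=
  while (nonempty 26) (seqm
    (ite (fun f => (top f 26 == Some true) && (top f 25 == Some true) &&
                   (top f 28 == None)) (push 28 true) (skip A K))
    (seqm (pop 25) (mv 26 27))).

Definition flag (b : bool) : bits := nseq b true.

Lemma runs_row_loop s row rest l m b : size row = size l ->
  s 25 = stk (row ++ rest) -> s 26 = stk l -> s 27 = stk m -> s 28 = stk (flag b) ->
  runs row_loop s (20 * size l + 1)
    (upd (upd (upd (upd s 25 (stk rest)) 26 (stk [::])) 27 (stk (rev l ++ m)))
      28 (stk (flag (b || has (fun p => p.1 && p.2) (zip row l))))).
Proof.
elim: l row m b s => [|a l IH] row m b s.
  case: row => //= _ E25 E26 E27 E28.
  apply: (@runs_ext _ _ _ s 1 s) => //; last by fin_upd; rewrite orbF.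
  by apply: runs_while0; rewrite (nonempty_reads _ E26) // le36.
case: row => //= c row [Es] E25 E26 E27 E28.
apply: runs_ext.
- apply: runs_whileS.
  + by rewrite (nonempty_reads _ E26) // le36.
  + apply: runs_seq.
      apply: (@runs_ite _ _ _ _ _ s 3 (upd s 28 (stk (flag (b || (c && a)))))).
      rewrite (top_reads _ E26) ?(top_reads _ E25) ?(top_reads _ E28) ?le36 //=.
      case: ifP => H.
        by apply: runs_ext; [apply: (runs_push _ E28)|by []|
          move=> i _; congr upd; case: a c b H {E25 E26 E28} => -[] []].
      apply: (@runs_ext _ _ _ _ 1); [exact: runs_skip|by []|].
      move=> i _; rewrite /upd; case: eqP => // ->; rewrite E28.
      by case: a c b H {E25 E26 E28} => -[] [].
    apply: runs_seq; first by apply: (@runs_pop _ _ _ _ (c :: row ++ rest)); lk.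
    by apply: (@runs_mv _ _ _ _ _ a l m); rewrite ?le36 //; lk.
  + by apply: (IH row (a :: m) (b || c && a)) => //; lk.
- by rewrite /=; lia.
- by fin_upd; rewrite ?orbA // rev_cons cat_rcons.
Qed.

Definition check_loop : tm :=
  while (nonempty 25) (seqm row_loop (seqm
    (ite (fun f => top f 28 == None)
       (ite (fun f => top f 29 == None) (push 29 true) (skip A K)) (pop 28))
    (move_all A K 27 26))).

(** The loop detects a remaining row by the bits left on 25, so the rows must not be empty. *)
Lemma runs_check_loop s rows l b : 0 < size l ->
  all (fun row => size row == size l) rows ->
  s 25 = stk (flatten rows) -> s 26 = stk l -> s 27 = stk [::] ->
  s 28 = stk [::] -> s 29 = stk (flag b) ->
  runs check_loop s (size rows * (30 * size l + 20) + 1)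
    (upd (upd s 25 (stk [::])) 29 (stk (flag (b ||
      ~~ all (fun row => has (fun p => p.1 && p.2) (zip row l)) rows)))).
Proof.
move=> l0; elim: rows b s => [|row rows IH] b s /=.
  move=> _ E25 E26 E27 E28 E29.
  apply: (@runs_ext _ _ _ s 1 s) => //; last by fin_upd; rewrite orbF.
  by apply: runs_while0; rewrite (nonempty_reads _ E25) // le36.
case/andP=> /eqP sr ar E25 E26 E27 E28 E29.
set h := has _ (zip row l).
apply: runs_ext.
- apply: runs_whileS.
  + rewrite (nonempty_reads _ E25) ?le36 //.
    by case: row sr {h E25} => //= sr; rewrite -sr in l0.
  + apply: runs_seq; first exact: (runs_row_loop (b := false) sr E25 E26 E27 E28).
    set s1 := upd _ 28 _.
    apply: runs_seq.
      apply: (@runs_ite _ _ _ _ _ s1 5 (upd (upd s1 28 (stk [::])) 29 (stk (flag (b || ~~ h))))).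
      have E28' : s1 28 = stk (flag h) by [].
      rewrite (top_reads _ E28') ?le36 //.
      case Eh : h E28' => E28' /=.
        apply: runs_ext; [exact: runs_pop E28'|by []|].
        by rewrite /s1; fin_upd; rewrite orbF.
      apply: (@runs_ext _ _ _ _ 4 (upd s1 29 (stk (flag true)))) => //; last first.
        by rewrite /s1 -/h Eh; fin_upd; rewrite orbT.
      apply: runs_ite; rewrite (@top_reads _ _ _ _ (flag b)) ?le36 //.
      case: (b) E29 => E29 /=; last exact: (@runs_push _ _ _ _ _ [::]).
      apply: (@runs_ext _ _ _ _ 1); [exact: runs_skip|by []|].
      by move=> i _; rewrite /upd; case: eqP => // ->.
    by apply: (@runs_move_all _ _ _ _ _ (rev l ++ [::]) [::]); rewrite ?le36 //; lk.
  + apply: (IH (b || ~~ h)) => //; lk => //.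
    by rewrite !cats0 revK.
- by rewrite cats0 size_rev; lia.
- fin_upd.
  + by rewrite negb_and orbA.
  + by rewrite !cats0 revK E26.
Qed.

Definition answer_tm : tm :=
  seqm (clear A K 0) (ite (fun f => top f 29 == None) (push 0 true) (push 0 false)).

Lemma runs_answer s x b : s 0 = stk x -> s 29 = stk (flag (~~ b)) ->
  runs answer_tm s (3 * size x + 10) (upd s 0 (stk [:: b])).
Proof.
move=> E0 E29; apply: runs_ext.
- apply: runs_seq; first exact: runs_clear E0.
  apply: (@runs_ite _ _ _ _ _ _ 3 (upd (upd s 0 (stk [::])) 0 (stk [:: b]))).
  rewrite (@top_reads _ _ _ _ (flag (~~ b))) ?le36 //.
  by case: (b) E29 => E29 /=; apply: (@runs_push _ _ _ _ _ [::]).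
- by lia.
- by fin_upd.
Qed.

(** The guest leaves a tape rather than a stack: its output is read rightwards up to the first
    symbol that is not a bit, as in [output_tape]. *)
Definition output_loop : tm :=
  while (nonempty 36) (seqm
    (ite (fun f => top f 36 == Some true) (push 27 true) (push 27 false))
    (act1 K 36 (fun a => (a, GoRight)))).

Lemma runs_output_loop s y m : output_tape (s 36) = y -> s 27 = stk m ->
  exists T, runs output_loop s (10 * size y + 1)
    (upd (upd s 36 T) 27 (stk (rev y ++ m))).
Proof.
elim: y m s => [|b y IH] m s Ey E27.
  exists (s 36); apply: (@runs_ext _ _ _ s 1 s) => //; last by fin_upd.
  apply: runs_while0; rewrite /nonempty top_tape //.
  by case: (s 36) Ey => l [[[]|]|] r.
have Eb : thead (s 36) = Some (inl b).
  by case: (s 36) Ey => l [[c|]|] r //= [->].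
have Ey2 : output_tape (move_tape GoRight (s 36)) = y.
  rewrite move_right; case: (s 36) Ey => l [[c|]|] r //= [_].
  by case: r => [|d r].
have [T HT] := IH (b :: m) (upd (upd s 27 (stk (b :: m))) 36 (move_tape GoRight (s 36))) Ey2 erefl.
exists T; apply: runs_ext.
- apply: runs_whileS; last exact: HT.
  + by rewrite /nonempty top_tape // Eb.
  + apply: runs_seq.
      apply: (@runs_ite _ _ _ _ _ s 3 (upd s 27 (stk (b :: m)))).
      rewrite top_tape // Eb /=.
      by case: b {Ey Eb HT IH}; apply: runs_push.
    apply: runs_act1; rewrite !updN //; apply: (@teq_move _ GoRight).
- by rewrite /=; lia.
- by fin_upd; rewrite rev_cons cat_rcons.
Qed.

End Pieces.

Lemma run_halted M x t t' : mhalt (cstate (run M x t)) -> t <= t' ->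
  run M x t' = run M x t.
Proof.
move=> h /subnK <-; elim: (t' - t) => // k IH.
by rewrite addSn runS IH /step h.
Qed.

Lemma output_head (A : finType) (T : tape A) b :
  output_tape T = [:: b] -> thead T = Some (inl b).
Proof. by case: T => l [[c|]|] r // [->]. Qed.

Lemma halts_with_head M x t b T : halts_with M x t [:: b] -> t <= T ->
  thead (ctape (run M x T) ord0) = Some (inl b).
Proof. by case=> h o tT; rewrite (run_halted h tT); apply: output_head. Qed.

Section Decider.
Variable A : finType.
Variable K : nat.

Lemma runs_halts (D : tm A K) x n s b :
  runs D (input_store A x) n s -> s 0 = stk A [:: b] ->
  exists2 t, t <= n & halts_with (machine_of D) x t [:: b].
Proof.
move=> H E; have [|t tn [Hh Hr]] := H (ctape (init_config (machine_of D) x)).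
  by move=> i; rewrite /input_store /= -val_eqE; case: (val i == 0).
exists t => //; split=> //.
by rewrite (teq_output (Hr ord0)) [s _]E output_stk.
Qed.

End Decider.

(** * P is contained in NP *)

Fixpoint undelimit (z : bits) : bits :=
  match z with
  | true :: b :: z' => b :: undelimit z'
  | _ => [::]
  end.

Lemma undelimit_pair x y : undelimit (pair_bits x y) = x.
Proof. by rewrite /pair_bits /delimit; elim: x => //= b x ->. Qed.

Lemma size_undelimit z : size (undelimit z) <= size z.
Proof.
elim/ltn_ind: {z}(size z) {-2}z (erefl (size z)) => n IH [|[] [|b z]] //= E.
by rewrite ltnS; apply: leq_trans (leqnSn _); apply: (IH (size z)); lia.
Qed.

Section Unwrap.
Variable M : machine.
Notation A := (maux M).
Notation K := (36 + mtapes M).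
Notation stk := (stk A).
Implicit Types s : store A.

Definition unwrap_loop : tm A K :=
  while (fun f => top f 0 == Some true) (seqm (pop A K 0)
    (ite (nonempty 0) (mv A K 0 8) (skip A K))).

Lemma runs_unwrap_loop s z m : s 0 = stk z -> s 8 = stk m ->
  exists z', runs unwrap_loop s (20 * size z + 1)
    (upd (upd s 0 (stk z')) 8 (stk (rev (undelimit z) ++ m))) /\ size z' <= size z.
Proof.
elim/ltn_ind: {z}(size z) {-2}z (erefl (size z)) m s => n IH z En m s E0 E8.
have stop : ~~ (ohead z == Some true) -> exists z', runs unwrap_loop s (20 * size z + 1)
    (upd (upd s 0 (stk z')) 8 (stk (rev (undelimit z) ++ m))) /\ size z' <= size z.
  move=> H; exists z; split=> //; apply: (@runs_ext _ _ _ s 1 s).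
  - by apply: runs_while0; rewrite (top_reads _ E0).
  - by lia.
  - by case: z H {En E0} (E0) => [|[] z] //= _ E0; fin_upd.
case: z En E0 stop => [|[] [|b z]] //= En E0; try by move=> H; apply: H.
  move=> _; exists [::]; split; last by [].
  apply: runs_ext; first apply: runs_whileS.
  - by rewrite (top_reads _ E0).
  - apply: runs_seq; first exact: runs_pop E0.
    apply: runs_ite; rewrite (@nonempty_reads _ _ _ _ [::]) //.
    exact: runs_skip.
  - by apply: runs_while0; rewrite (@top_reads _ _ _ _ [::]).
  - by lia.
  - by fin_upd.
move=> _; have [|z' [Hz' sz']] := IH (size z) _ z erefl (b :: m)
  (upd (upd (upd s 0 (stk (b :: z))) 8 (stk (b :: m))) 0 (stk z)) erefl erefl.
  by lia.
exists z'; split; last lia.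
apply: runs_ext; first apply: runs_whileS.
- by rewrite (top_reads _ E0).
- apply: runs_seq; first exact: runs_pop E0.
  apply: runs_ite; rewrite (@nonempty_reads _ _ _ _ (b :: z)) //=.
  by apply: (@runs_mv _ _ _ _ _ b z m).
- exact: Hz'.
- by lia.
- by fin_upd; rewrite rev_cons cat_rcons.
Qed.

(** Membership in P requires an answer on every string, hence also on strings that are not pairs;
    there too the guest is run on the value of [undelimit]. *)
Definition verifier : tm A K :=
  seqm unwrap_loop (seqm (move_all A K 8 36) (seqm (guest_tm M) (seqm (clear A K 0)
    (ite (fun f => top f 36 == Some true) (push A K 0 true) (push A K 0 false))))).

Lemma runs_verifier z t b : halts_with M (undelimit z) t [:: b] ->
  exists2 s, runs verifier (input_store A z) (60 * size z + t + 40) s &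
    s 0 = stk [:: b].
Proof.
move=> Hh; have sz := size_undelimit z.
have [z' [H1 sz']] := @runs_unwrap_loop (input_store A z) z [::] erefl erefl.
set s1 := upd _ 8 _ in H1.
have H2 : runs (move_all A K 8 36) s1 (10 * size z + 1)
    (upd (upd s1 36 (stk (undelimit z))) 8 (stk [::])).
  apply: runs_ext.
  - by apply: (@runs_move_all _ _ 8 36 _ (rev (undelimit z) ++ [::]) [::]).
  - by rewrite cats0 size_rev; lia.
  - by rewrite !cats0 revK.
set s2 := upd _ 8 _ in H2.
have [|T [oT [s3 [H3 [E36 Es3]]]]] := @runs_guest M s2 _ _ _ Hh erefl.
  by move=> i Hi; rewrite /s2 /s1 /input_store !updN ?ifN //; lia.
have E0 : s3 0 = stk z' by rewrite Es3.
have H4 := runs_clear (K := K) (leq0n _) E0.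
exists (upd (upd s3 0 (stk [::])) 0 (stk [:: b])) => //.
apply: runs_ext.
- apply: (runs_seq H1); apply: (runs_seq H2); apply: (runs_seq H3).
  apply: (runs_seq H4); apply: (@runs_ite _ _ _ _ _ _ 3).
  rewrite top_tape // updN // E36 (output_head oT) /=.
  by case: (b); apply: (@runs_push _ _ _ _ _ [::]).
- by lia.
- by [].
Qed.

End Unwrap.

(** The verifier ignores the certificate, which is bounded by the zero polynomial; the work lies in
    extracting [x] from the pair on a machine. *)
Lemma P_sub_NP L : inP L -> inNP L.
Proof.
case=> M [p HM]; exists (fun z => L (undelimit z)), 0%R; split; last first.
  move=> x; split=> [Lx|[y [_]]]; last by rewrite undelimit_pair.
  by exists [::]; split=> //; rewrite undelimit_pair.
have [q Hq] : polyb (fun n => 60 * n + p.[n]%R + 40) by polyb_tac.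
exists (machine_of (verifier M)), q => z.
have [t [b [tp Hh bL]]] := HM (undelimit z).
have [s Hs Es] := runs_verifier Hh.
have [t' t't Ht'] := runs_halts Hs Es.
exists t', b; split=> //.
apply: leq_trans t't (leq_trans _ (Hq _)).
have := horner_mono p (size_undelimit z); lia.
Qed.

(** * Deciding a language in NP by means of the approximation algorithm *)

Section NP.
Variables (MV : machine) (qV pL : {poly nat}) (V L : language).
Hypothesis V_decided : forall z, exists t b,
  [/\ t <= qV.[size z]%R, halts_with MV z t [:: b] & b <-> V z].
Hypothesis L_verified : forall x, L x <->
  exists y : bits, size y <= pL.[size x]%R /\ V (pair_bits x y).
(* [qT] bounds the time taken by the verifier on the certificates allowed. *)
Variable qT : {poly nat}.
Hypothesis qT_ge : forall n, qV.[n.*2.+1 + pL.[n]]%R <= qT.[n]%R.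

Section Reduction.
Variable x : bits.
Notation n := (size x).
Definition time := horner_rec qT n.
Definition len := horner_rec pL n + n.*2.+1.
Definition data := csp_data x len time.
Notation B := (time.+2).

Definition tableau_instance : fair_instance :=
  csp_instance (kind := kind MV) (value := value MV) (rule := rule MV)
    (inl (mstart MV)) (B := B) (literal data) isT.

Lemma satisfiable_tableau :
  satisfiable (kind := kind MV) (value := value MV) (rule := rule MV) B
    (literal data) <-> L x.
Proof.
have sz : size (delimit x) = n.*2.+1 by exact: size_delimit.
have le : size (delimit x) <= len by rewrite sz leq_addl.
have lenB : len - size (delimit x) = pL.[n]%R by rewrite sz addnK.
have := @tableau_correct MV (delimit x) len time data erefl erefl erefl erefl erefl le.
rewrite lenB => H; apply: iff_trans (iff_trans _ H) _.
  split=> -[s Hs]; exists s => C.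
    move=> tB iB; have [|c] := Hs C; first by rewrite mem_grid tB.
    by rewrite mem_grid => /andP[ctB ciB] lC; exists c.
  rewrite mem_grid => /andP[tB iB]; have [c [ctB ciB lC]] := Hs C tB iB.
  by exists c => //; rewrite mem_grid ctB.
apply: iff_trans (iff_sym (L_verified x)).
(* By [qT_ge] the verifier has halted at the time [time] on every admissible certificate, so the
   scanned symbol is its verdict. *)
have V_head y : size y <= pL.[n]%R ->
    thead (ctape (run MV (delimit x ++ y) time) ord0) = Some (inl true) <->
    V (pair_bits x y).
  move=> sy; have [t [b [tq Hh bV]]] := V_decided (pair_bits x y).
  rewrite (halts_with_head Hh) -?bV; first by split=> [[->]|->].
  apply: leq_trans tq (leq_trans _ (qT_ge n)); apply: horner_mono.
  by rewrite /pair_bits size_cat sz leq_add2l.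
by split=> [[y sy /(V_head y sy)]|[y [sy /(V_head y sy)]]]; exists y.
Qed.

End Reduction.

Variables (M : machine) (qM : {poly nat}).
Notation A := (maux M).
Notation K := (36 + mtapes M).
Notation stk := (stk A).

Definition decider : tm A K :=
  seqm (ready_tm A K pL qT) (seqm (compile A K 0 (print_instance MV))
  (seqm (move_all A K 8 36) (seqm (guest_tm M) (seqm (output_loop A K)
  (seqm (move_all A K 27 26) (seqm (compile A K 0 (print_close MV))
  (seqm (move_all A K 8 25) (seqm (check_loop A K) (answer_tm A K))))))))).

(** The ticks of both programs are added because the second one starts with the counter left by the
    first. *)
Definition room n :=
  let B := (horner_rec qT n).+2 in
  n.*2 + horner_rec pL n + B + ticks B (print_instance MV) +
  ticks B (print_close MV) + 10.

(** [c] bounds both the time to print the instance and its length, hence the argument of [qM].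
    Likewise [d] bounds the size of the matrix, and so the number of points. *)
Definition decider_steps n :=
  let c := steps (print_instance MV) (room n) in
  let d := steps (print_close MV) (room n) in
  ready_steps pL qT n + c + 10 * c + qM.[c]%R + 20 * d + d + 10 * d +
  d * (30 * d + 20) + 3 * n + 100.

Lemma runs_decider x t (S : {set 'I_(npoints (tableau_instance x))}) :
  halts_with M (encode_instance (tableau_instance x)) t (encode_solution S) ->
  t <= qM.[size (encode_instance (tableau_instance x))]%R ->
  exists2 s, runs decider (input_store A x) (decider_steps (size x)) s &
    s 0 = stk [:: covers (kind := kind MV) (value := value MV)
      (rule := rule MV) (time x).+2 (literal (data x)) (encode_solution S)].
Proof.
move=> Hh Ht; set n := size x; set T := time x; set Ln := len x.
have bigK : 36 <= K by apply: leq_addr.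
set dat := data x; set I := tableau_instance x in S Hh Ht *.
set B := T.+2; set U := room n.
have UE : U = n.*2 + horner_rec pL n + B + ticks B (print_instance MV) +
  ticks B (print_close MV) + 10 by [].
have BU : B < U by rewrite UE; lia.
have datU k : 0 < k < 6 -> size (dat k) < U.
  rewrite UE /B; move: (ticks _ _) (ticks _ _) => t1 t2; case: k => [|[|[|[|[|[|k]]]]]] //= _.
  - by rewrite size_delimit -/n; lia.
  - by rewrite size_nseq /len -/n; lia.
  - by rewrite size_rcons size_nseq -/T; lia.
  - by rewrite size_rcons size_nseq -/T; lia.
  - by lia.
pose s1 := ready_store A x Ln T.
have H1 : runs (ready_tm A K pL qT) (input_store A x) (ready_steps pL qT n) s1.
  exact: (@runs_ready A K bigK pL qT x).
have wr i : i \in wregs = [|| i == 10, i == 12, i == 14, i == 16, i == 18,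
   i == 20, i == 22 | i == 24] by rewrite !inE.
have inv1 : loop_inv dat B [::] 0 [::] s1.
  split=> // [k k6|i i8].
    by rewrite /s1 /ready_store wr; case: k k6 => [|[|[|[|[|[|k]]]]]].
  rewrite nth_nil; split=> [|_].
    by do 8?[case: i i8 => [|i] i8 //].
  by do 8?[case: i i8 => [|i] i8 //].
have [||c1 o1 H2] := compile_ok bigK BU datU (wf_print_instance MV : wf (size [::]) _) inv1.
- by [].
- by rewrite UE add0n; lia.
set st1 := ev _ _ _ _ _ in c1 o1 H2.
have E1 : st1.2 = encode_instance I.
  by rewrite /I /tableau_instance encode_csp /st1 ev_print_instance.
set enc := encode_instance I in Hh Ht E1.
set s2 := result s1 st1 in H2.
have H3 : runs (move_all A K 8 36) s2 (10 * size enc + 1)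
    (upd (upd s2 36 (stk enc)) 8 (stk [::])).
  apply: runs_ext.
  - by apply: (@runs_move_all _ _ 8 36 _ (rev enc) [::]); rewrite /s2 /result ?E1.
  - by rewrite size_rev.
  - by rewrite cats0 revK.
set s3 := upd _ 8 _ in H3.
have [|T4 [oT4 [s4 [H4 [E36 Es4]]]]] := @runs_guest M s3 _ _ _ Hh erefl.
  move=> i Hi; rewrite /s3 /s2 /result /s1 /ready_store !updN ?wr; try lia.
  rewrite ifN; last lia. rewrite ifN; last lia.
  by case: i Hi => [|[|[|[|[|[|i]]]]]].
set sol := encode_solution S in Hh oT4 *.
have E27 : s4 27 = stk [::] by rewrite Es4.
have [T5 H5] := runs_output_loop bigK (etrans (congr1 _ E36) oT4) E27.
set s5 := upd _ 27 _ in H5.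
have ssol : size sol = size (points (kind MV) (value MV) (rule MV) B).
  by rewrite size_map size_enum_ord.
have H6 : runs (move_all A K 27 26) s5 (10 * size sol + 1)
    (upd (upd s5 26 (stk sol)) 27 (stk [::])).
  apply: runs_ext.
  - by apply: (@runs_move_all _ _ 27 26 _ (rev sol ++ [::]) [::]); rewrite // /s5 !updN // Es4.
  - by rewrite cats0 size_rev.
  - by rewrite !cats0 revK.
set s6 := upd _ 27 _ in H6.
have Es6 i : i < 25 -> s6 i = s3 i.
  move=> Hi; rewrite /s6 /s5 /upd; do 4![rewrite ifN; last lia].
  by apply: Es4; lia.
have inv6 : loop_inv dat B [::] st1.1 [::] s6.
  have [E6 E7 E8 Ed Ev] : loop_inv dat B [::] st1.1 st1.2 s2 :=
    inv_result bigK st1 inv1.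
  have Es3 i : i < 25 -> i != 8 -> s3 i = s2 i.
    move=> Hi H8; rewrite /s3 /upd (negbTE H8) ifN //.
    by apply: contraTneq Hi => ->.
  split; try by rewrite Es6.
  - by move=> k k6; rewrite Es6 ?Es3; [exact: Ed|lia|lia|lia].
  - move=> i i8; have [Ev1 Ev2] := Ev i i8; split=> [|Hi].
      by rewrite Es6 ?Es3; [exact: Ev1|lia|lia|lia].
    by rewrite Es6 ?Es3; [exact: Ev2|lia|lia|lia].
have [||c2 o2 H7] := compile_ok bigK BU datU
  (wf_distances _ _ : wf (size [::]) (print_close MV)) inv6.
- by [].
- by apply: leq_trans (leq_add c1 (leqnn _)) _; rewrite UE; lia.
set st2 := ev _ _ _ _ _ in c2 o2 H7.
set rows := [seq [seq gap (literal dat) p q < 3 | q <- points (kind MV) (value MV) (rule MV) B]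
  | p <- points (kind MV) (value MV) (rule MV) B].
have E2 : st2.2 = flatten rows by rewrite /st2 ev_print_close.
set s7 := result s6 st2 in H7.
have H8 : runs (move_all A K 8 25) s7 (10 * size (flatten rows) + 1)
    (upd (upd s7 25 (stk (flatten rows))) 8 (stk [::])).
  apply: runs_ext.
  - apply: (@runs_move_all _ _ 8 25 _ (rev (flatten rows)) [::]) => //.
      by rewrite /s7 /result updE E2.
    by rewrite /s7 /s6 /s5 /result !updN // Es4.
  - by rewrite size_rev.
  - by rewrite cats0 revK.
set s8 := upd _ 8 _ in H8.
have rows_size : size rows = size sol by rewrite size_map ssol.
have sol0 : 0 < size sol.
  by rewrite ssol; case: (points _ _ _ _) (z_in (kind MV) (value MV) (rule MV) B).
have rows_all : all (fun row => size row == size sol) rows.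
  by rewrite all_map; apply/allP => p _; rewrite /= size_map ssol.
have P25 : s8 25 = stk (flatten rows) by [].
have P26 : s8 26 = stk sol by [].
have P27 : s8 27 = stk [::] by [].
have P28 : s8 28 = stk [::] by rewrite -[LHS]/(s4 28) Es4.
have P29 : s8 29 = stk (flag false) by rewrite -[LHS]/(s4 29) Es4.
have H9 := runs_check_loop bigK sol0 rows_all P25 P26 P27 P28 P29.
set s9 := upd _ 29 _ in H9.
set b := covers _ _ sol.
have E0 : s9 0 = stk x.
  by rewrite /s9 /s8 /s7 /result !updN // Es6.
have H10 := @runs_answer A K bigK s9 x b E0 erefl.
exists (upd s9 0 (stk [:: b])) => //.
apply: runs_ext.
- apply: (runs_seq H1); apply: (runs_seq H2); apply: (runs_seq H3).
  apply: (runs_seq H4); apply: (runs_seq H5); apply: (runs_seq H6).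
  apply: (runs_seq H7); apply: (runs_seq H8); exact: (runs_seq H9 H10).
- rewrite rows_size /decider_steps -/n -/U.
  have e1 : size enc <= steps (print_instance MV) U by rewrite -E1; exact: o1.
  have tc := leq_trans Ht (horner_mono qM e1).
  have e2 : size (flatten rows) <= steps (print_close MV) U by rewrite -E2; exact: o2.
  have e3 : size sol * size sol = size (flatten rows).
    rewrite -{1}rows_size; elim: (rows) rows_all => //= r rs IH /andP[/eqP Er ar].
    by rewrite size_cat mulSn (IH ar) Er.
  move: (steps (print_instance MV) U) (steps (print_close MV) U) (size enc)
    (size (flatten rows)) (size sol) e1 e2 e3 sol0 tc => c d e f m e1 e2 e3 m0 tc.
  have md : m <= d by apply: leq_trans e2; rewrite -e3 leq_pmulr.
  have : m * (30 * m + 20) <= d * (30 * d + 20) by rewrite leq_mul // leq_add2r leq_mul2l md orbT.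
  move: (m * _) (d * _) (ready_steps _ _ _) (qM.[c])%R tc => u v w k; lia.
- by [].
Qed.

Lemma polyb_decider : polyb decider_steps.
Proof.
have H (q : {poly nat}) : polyb (horner_rec q).
  by apply: (@polyb_horner q id); exact: polyb_id.
have [HP HT] := (H pL, H qT); have HR := polyb_ready pL qT.
have room_bound t1 t2 : polyb t1 -> polyb t2 -> polyb (fun n =>
    n.*2 + horner_rec pL n + (horner_rec qT n).+2 + t1 n + t2 n + 10).
  by move=> H1 H2; polyb_tac.
have HU : polyb room.
  by apply: room_bound; apply: polyb_ticks; do 2!apply: polyb_succ.
have bound c d : polyb c -> polyb d -> polyb (fun n =>
    ready_steps pL qT n + c n + 10 * c n + qM.[c n]%R + 20 * d n + d n + 10 * d n +
    d n * (30 * d n + 20) + 3 * n + 100).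
  by move=> Hc Hd; polyb_tac.
by apply: bound; apply: polyb_steps.
Qed.

End NP.

Lemma inNP_inP (R : realType) (eps : R) (M : machine) (L : language) :
  (0 < eps)%R -> poly_time_approx one_per_group (3 - eps)%R M -> inNP L -> inP L.
Proof.
move=> eps0 [qM HM] [V [pL [[MV [qV HV]] HL]]].
have [qT HqT] : polyb (fun n => qV.[n.*2.+1 + pL.[n]]%R).
  by apply: polyb_horner; apply: polyb_add; [apply: polyb_succ|apply: polyb_horner];
    do ?apply: polyb_double; exact: polyb_id.
have [q Hq] := polyb_decider MV pL qT qM.
exists (machine_of (decider MV pL qT M)), q => x.
have [t [S [tq Hh fS cS]]] := HM (tableau_instance MV pL qT x) (csp_one_per_group _ _ _).
have [s Hs Es] := runs_decider Hh tq.
have [t' t't Ht'] := runs_halts Hs Es.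
exists t', (covers (kind := kind MV) (value := value MV) (rule := rule MV)
  (time qT x).+2 (literal (data pL qT x)) (encode_solution S)).
split=> //; first by apply: leq_trans t't (Hq _).
(* A positive answer is correct for any feasible selection; the ratio is used only to show that a
   satisfiable instance is recognized. *)
rewrite -(satisfiable_tableau HV HL HqT); split; first exact: covers_satisfiable fS.
move=> sat; apply: (@cost_covers _ _ _ (None : kind MV)).
have opt1 : (opt (tableau_instance MV pL qT x) <= 1)%R by exact: satisfiable_opt.
have opt0 : (0 <= opt (tableau_instance MV pL qT x))%R.
  by apply/bigmin_geP; split=> [|S' _]; exact: bigmax_ge_id.
rewrite -(ltr_rat R) (le_lt_trans cS) // ratr_nat.
move: opt1 opt0; rewrite -(ler_rat R) -[(0 <= opt _)%R](ler_rat R) rmorph0 rmorph1.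
set o := ratr _; move=> o1 o0.
(* When [eps] is at least 3 the factor is not positive, and [opt <= 1] cannot be multiplied by it;
   the bound is then at most 0. *)
have [o_le|o_gt] := lerP (3 - eps)%R 0%R.
  by apply: le_lt_trans (mulr_le0_ge0 o_le o0) _; rewrite ltr0n.
apply: (@le_lt_trans _ _ (3 - eps)%R); first by rewrite ler_piMr // ltW.
by rewrite ltrBlDr ltrDl.
Qed.

Local Open Scope ring_scope.

Theorem theorem2 (R : realType) (hPNP : P_neq_NP) (eps : R) (heps : 0 < eps) :
  ~ exists M : machine, poly_time_approx one_per_group (3 - eps) M.
Proof.
case=> M HM; apply: hPNP => L; split; first exact: P_sub_NP.
exact: inNP_inP heps HM.
Qed.
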